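(* Let $\gamma\in(1/2,1)$, let $x:[0,T]\to\mathbb R^{1,d}$ be $\gamma$-Hölder continuous and let $\tilde x^1\in\tilde{\mathcal C}^\gamma_{2,\gamma}([0,T];\mathbb R^{1,d})$ satisfy $\tilde\delta\tilde x^1=0$. Let $a_0\in\mathbb R^{1,m}$ and $\sigma:\mathbb R^{1,m}\to\mathbb R^{d,m}$ be of class $C^2$, bounded with bounded first and second derivatives. Then the equation $$\tilde y_0\equiv0,\qquad \tilde\delta\tilde y=\mathcal J\Big(\tilde dx\,\sigma\Big(a_0+\int_0^\infty\hat\phi(\eta)\tilde y(\eta)d\eta\Big)\Big)$$ admits a unique solution $\tilde y$ in $\tilde{\mathcal C}^{0,\gamma}_{1,\gamma}([0,T];\mathbb R^{1,m})$.
   Context: Measurable $\hat\phi:(0,\infty)\to\mathbb R$ is fixed. $\mathcal L_\gamma(V)$ is the space of measurable $g:[0,\infty)\to V$ with $\mathcal N[g;\mathcal L_\gamma]=\int_0^\infty|\hat\phi(\xi)|(1+\xi^\gamma)\|g(\xi)\|d\xi<\infty$. $\tilde{\mathcal C}_{k,\gamma}$ denotes continuous maps from $\{t_1\ge\dots\ge t_k\}\subset[0,T]^k$ into $\mathcal L_\gamma$. $(\tilde\delta f)_{ts}(\xi)=f_t(\xi)-e^{-\xi(t-s)}f_s(\xi)$ and $(\tilde\delta B)_{tus}(\xi)=B_{ts}(\xi)-B_{tu}(\xi)-e^{-\xi(t-u)}B_{us}(\xi)$. $\mathcal N[B;\tilde{\mathcal C}^\gamma_{2,\gamma}]=\sup_{s<t}\mathcal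 N[B_{ts};\mathcal L_\gamma]/|t-s|^\gamma$. $\tilde{\mathcal C}^{0,\gamma}_{1,\gamma}$ is the set of $\tilde y\in\tilde{\mathcal C}_{1,\gamma}$ with finite norm $\mathcal N[\tilde y;\tilde{\mathcal C}^{0,\gamma}_{1,\gamma}]=\sup_s\mathcal N[\tilde y_s;\mathcal L_\gamma]+\mathcal N[\tilde\delta\tilde y;\tilde{\mathcal C}^\gamma_{2,\gamma}]$. For a $\gamma$-Hölder path $z:[0,T]\to\mathbb R^{d,m}$, the Young convolutional integral is $\mathcal J_{ts}(\tilde dx\,z)=\tilde x^1_{ts}z_s+\tilde\Lambda[h]_{ts}$ with $h_{tus}=\tilde x^1_{tu}(z_u-z_s)$, where $\tilde\Lambda$ is the convolutional sewing map: for $\mu>1$ and $\tilde h$ of finite norm $\inf\sum_i\sup_{s<u<t}\mathcal N[\tilde h^i_{tus};\mathcal L_\gamma]|t-u|^{-\rho_i}|u-s|^{-(\mu-\rho_i)}$ (infimum over $\tilde h=\sum_i\tilde h^i$, $\rho_i\in(0,\mu)$) of the form $\tilde\delta B$, $\tilde\Lambda\tilde h$ is the unique two-parameter element with $\sup_{s<t}\mathcal N[(\tilde\Lambda\tilde h)_{ts};\mathcal L_\gamma]/|t-s|^\mu<\infty$ and $\tilde\delta\tilde\Lambda\tilde h=\tilde h$. *)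

(* Defs.v *)
From HB Require Import structures.
From mathcomp Require Import all_boot all_order all_algebra.
From mathcomp Require Import all_classical all_reals all_analysis.
Set Implicit Arguments. Unset Strict Implicit. Unset Printing Implicit Defensive.
Import Order.TTheory GRing.Theory Num.Theory.
Import numFieldNormedType.Exports.
Local Open Scope classical_set_scope.
Local Open Scope ring_scope.

Section Defs.
Variable R : realType.

Definition NL (phi : R -> R) (gamma : R) (p q : nat) (g : R -> 'M[R]_(p, q)) : \bar R :=
  (\int[lebesgue_measure]_(xi in (`]0%R, +oo[ : set R))
     (`|phi xi| * (1 + xi `^ gamma) * `|g xi|)%:E)%E.

Definition in_Lg (phi : R -> R) (gamma : R) (p q : nat) (g : R -> 'M[R]_(p, q)) : Prop :=
  (forall i j, measurable_fun (`]0%R, +oo[ : set R) (fun xi => g xi i j)) /\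
  (NL phi gamma g < +oo)%E.

Definition in_time (T t : R) := 0 <= t <= T.

Definition cdelta1 (p q : nat) (f : R -> R -> 'M[R]_(p, q)) (t s : R) : R -> 'M[R]_(p, q) :=
  fun xi => f t xi - expR (- (xi * (t - s))) *: f s xi.

Definition cdelta2 (p q : nat) (B : R -> R -> R -> 'M[R]_(p, q)) (t u s : R)
  : R -> 'M[R]_(p, q) :=
  fun xi => B t s xi - B t u xi - expR (- (xi * (t - u))) *: B u s xi.

Definition hoelder_path (T gamma : R) (p q : nat) (x : R -> 'M[R]_(p, q)) : Prop :=
  exists C : R, forall s t, in_time T s -> in_time T t ->
    `|x t - x s| <= C * `|t - s| `^ gamma.

Definition tC1 (phi : R -> R) (gamma T : R) (p q : nat) (y : R -> R -> 'M[R]_(p, q)) : Prop :=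
  (forall t, in_time T t -> in_Lg phi gamma (y t)) /\
  (forall t, in_time T t -> forall e : R, 0 < e -> exists2 d : R, 0 < d &
     forall t', in_time T t' -> `|t' - t| < d ->
       (NL phi gamma (fun xi => (y t' xi - y t xi)%R) < e%:E)%E).

Definition tC2 (phi : R -> R) (gamma T : R) (p q : nat) (B : R -> R -> R -> 'M[R]_(p, q))
  : Prop :=
  (forall t s, 0 <= s <= t -> t <= T -> in_Lg phi gamma (B t s)) /\
  (forall t s, 0 <= s <= t -> t <= T -> forall e : R, 0 < e -> exists2 d : R, 0 < d &
     forall t' s', 0 <= s' <= t' -> t' <= T -> `|t' - t| < d -> `|s' - s| < d ->
       (NL phi gamma (fun xi => (B t' s' xi - B t s xi)%R) < e%:E)%E).

Definition hoelder2_fin (phi : R -> R) (gamma T mu : R) (p q : nat)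
  (B : R -> R -> R -> 'M[R]_(p, q)) : Prop :=
  exists C : R, forall s t, 0 <= s -> s < t -> t <= T ->
    (NL phi gamma (B t s) <= (C * (t - s) `^ mu)%:E)%E.

Definition tC2_hoelder (phi : R -> R) (gamma T : R) (p q : nat)
  (B : R -> R -> R -> 'M[R]_(p, q)) : Prop :=
  tC2 phi gamma T B /\ hoelder2_fin phi gamma T gamma B.

Definition tC10 (phi : R -> R) (gamma T : R) (p q : nat) (y : R -> R -> 'M[R]_(p, q))
  : Prop :=
  tC1 phi gamma T y /\
  (exists C : R, forall s, in_time T s -> (NL phi gamma (y s) <= C%:E)%E) /\
  hoelder2_fin phi gamma T gamma (fun t s => cdelta1 y t s).

(* domain of the convolutional sewing map: h has finite norm
   inf sum_i sup N[h^i_{tus}] |t-u|^{-rho_i} |u-s|^{-(mu-rho_i)} *)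
Definition sewing_dom (phi : R -> R) (gamma T mu : R) (p q : nat)
  (h : R -> R -> R -> R -> 'M[R]_(p, q)) : Prop :=
  exists (n : nat) (hs : 'I_n -> R -> R -> R -> R -> 'M[R]_(p, q)) (rho : 'I_n -> R),
    (forall i, 0 < rho i < mu) /\
    (forall t u s, 0 <= s <= u -> u <= t -> t <= T ->
        forall xi, h t u s xi = \sum_(i < n) hs i t u s xi) /\
    (forall i t u s, 0 <= s <= u -> u <= t -> t <= T -> in_Lg phi gamma (hs i t u s)) /\
    (forall i, exists C : R, forall t u s, 0 <= s -> s < u -> u < t -> t <= T ->
        (NL phi gamma (hs i t u s)
           <= (C * (t - u) `^ (rho i) * (u - s) `^ (mu - rho i))%:E)%E).

(* Lam is (a representative of) the convolutional sewing map applied to h: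
   mu > 1, h is in the domain, Lam is mu-Hoelder in L_gamma and
   tilde-delta Lam = h (equality in L_gamma). *)
Definition is_csewing (phi : R -> R) (gamma T mu : R) (p q : nat)
  (h : R -> R -> R -> R -> 'M[R]_(p, q)) (Lam : R -> R -> R -> 'M[R]_(p, q)) : Prop :=
  1 < mu /\ sewing_dom phi gamma T mu h /\
  (forall t s, 0 <= s <= t -> t <= T -> in_Lg phi gamma (Lam t s)) /\
  hoelder2_fin phi gamma T mu Lam /\
  (forall t u s, 0 <= s <= u -> u <= t -> t <= T ->
     NL phi gamma (fun xi => cdelta2 Lam t u s xi - h t u s xi) = 0%E).

(* J_{ts}(d~x z) = x~1_{ts} z_s + Lam[h]_{ts},  h_{tus} = x~1_{tu} (z_u - z_s).
   young_conv ... J says that J is (a representative of) this integral. *)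
Definition young_conv (phi : R -> R) (gamma T : R) (d m : nat)
  (x1 : R -> R -> R -> 'rV[R]_d) (z : R -> 'M[R]_(d, m))
  (J : R -> R -> R -> 'rV[R]_m) : Prop :=
  exists (mu : R) (Lam : R -> R -> R -> 'rV[R]_m),
    is_csewing phi gamma T mu (fun t u s xi => x1 t u xi *m (z u - z s)) Lam /\
    forall t s, 0 <= s <= t -> t <= T ->
      NL phi gamma (fun xi => J t s xi - (x1 t s xi *m z s + Lam t s xi)) = 0%E.

Definition phi_int (phi : R -> R) (m : nat) (g : R -> 'rV[R]_m) : 'rV[R]_m :=
  \row_j Rintegral lebesgue_measure (`]0%R, +oo[ : set R) (fun eta => phi eta * g eta 0 j).

Definition C2b (d m : nat) (sigma : 'rV[R]_m -> 'M[R]_(d, m)) : Prop :=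
  (exists C : R, forall a, `|sigma a| <= C) /\
  (forall a, differentiable sigma a) /\
  (forall v a, differentiable (fun b => 'd sigma b v) a) /\
  (forall v w, continuous (fun a => 'd (fun b => 'd sigma b v) a w)) /\
  (exists C1 : R, forall a v, `|'d sigma a v| <= C1 * `|v|) /\
  (exists C2 : R, forall a v w, `|'d (fun b => 'd sigma b v) a w| <= C2 * `|v| * `|w|).

Definition is_solution (phi : R -> R) (gamma T : R) (d m : nat)
  (x1 : R -> R -> R -> 'rV[R]_d) (a0 : 'rV[R]_m) (sigma : 'rV[R]_m -> 'M[R]_(d, m))
  (y : R -> R -> 'rV[R]_m) : Prop :=
  tC10 phi gamma T y /\
  NL phi gamma (y 0) = 0%E /\
  young_conv phi gamma T x1 (fun s => sigma (a0 + phi_int phi (y s)))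
    (fun t s => cdelta1 y t s).

End Defs.

(* Main.v *)
Require Import Defs.
From HB Require Import structures.
From mathcomp Require Import all_boot all_order all_algebra.
From mathcomp Require Import all_classical all_reals all_analysis.
From mathcomp Require Import measurable_realfun ring lra.
Import Order.TTheory GRing.Theory Num.Theory.
Import numFieldNormedType.Exports.
Local Open Scope classical_set_scope.
Local Open Scope ring_scope.
Set Implicit Arguments.
Unset Strict Implicit.

(** A path y solves the equation exactly when the remainder
    delta y_ts - x1_ts z_s, z = sigma (a0 + int phi y), is O(|t - s|^mu) in L_gamma for
    some mu > 1: the sewing term Lam is that remainder, and its delta is then automatically
    x1_tu (z_u - z_s). Only four features of L_gamma matter: it is complete, e^{-xi t} acts
    on it as a contraction semigroup S, the functional ell = int phi is bounded, and
    |ell (v - S_t v)| <= t^gamma |v|, which makes ell o y a gamma-Hoelder path.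

    Repeated bisection of [s, t] turns any a priori bound of order mu > 1 on the remainder
    into a bound by csew K H |t - s|^(2 gamma), H being the Hoelder constant of z. Integrals
    are built from integrands frozen on dyadic grids, which converge geometrically because
    2 gamma > 1. The Picard map is a contraction for the Hoelder seminorm restricted to
    |t - s| <= tau and weighted by 2^(-t/tau): for tau small this covers all of [0, T] at
    once, and the same estimate gives uniqueness. *)

(** A path in L_gamma with Hoelder twisted increments need not have Hoelder ordinary increments: the
    weight 1 + xi^gamma is used up by the norm, so S_t v - v tends to 0 without a rate. The equation
    closes because its coefficient sees y only through ell, which integrates against phi without
    xi^gamma and can trade that factor for t^gamma. For the contraction, the difference of two
    integrands must again be Hoelder, with a constant proportional to the distance of the two paths.
    This takes a second difference of sigma, hence its second derivative, and the Hoelder constant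
    of one of the paths. A window of length tau makes single increments small, but the bound M of
    sup N(y) adds up about T / tau of them and is of order tau^(gamma - 1). In the estimates M has
    to be small only after multiplication by tau^gamma, and tau^(2 gamma - 1) is small because gamma
    > 1/2. *)

(** * Geometric limits and powers of one half *)

Section RealLemmas.
Variable R : realType.
Implicit Types (q e a b C r mu gamma : R).

Lemma expr_small q e : 0 <= q < 1 -> 0 < e -> exists n, q ^+ n <= e.
Proof.
move=> /andP[q0 q1] e0.
have : (fun n => q ^+ n) @ \oo --> (0 : R) by apply: cvg_expr; rewrite ger0_norm.
move=> /cvgr0Pnorm_lt /(_ e e0)[n _ /(_ n (leqnn n))] /=.
by rewrite ger0_norm ?exprn_ge0// => /ltW; exists n.
Qed.

(** The limits of integrals and iterates below have geometric errors, and inequalities pass to them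
    through this lemma. The sign of [C] is free. *)
Lemma le_expr_limit q C a b : 0 <= q < 1 ->
  (forall n, a <= b + C * q ^+ n) -> a <= b.
Proof.
move=> q01 h; apply/ler_addgt0Pr => e e0.
have C0 : 0 < `|C| + 1 by rewrite ltr_wpDl.
have [n qn] := expr_small q01 (divr_gt0 e0 C0).
apply: le_trans (h n) _; rewrite lerD2l.
have q0 : 0 <= q ^+ n by case/andP: q01 => ? _; exact: exprn_ge0.
apply: (@le_trans _ _ ((`|C| + 1) * q ^+ n)).
  by apply: ler_wpM2r => //; rewrite (le_trans (ler_norm _))// lerDl.
by rewrite mulrC -ler_pdivlMr.
Qed.

Lemma powR_half r mu : 0 <= r -> (r / 2) `^ mu = 2^-1 `^ mu * r `^ mu.
Proof. by move=> r0; rewrite mulrC powRM// invr_ge0. Qed.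

Lemma powR_half_lt1 mu : 0 < mu -> (2^-1 : R) `^ mu < 1.
Proof.
move=> mu0; have e : 1 = 1 `^ mu :> R by rewrite powR1.
rewrite [ltRHS]e.
by apply: gt0_ltr_powR; rewrite ?nnegrE ?invr_ge0//; lra.
Qed.

(** The left side equals (1/2)^(mu - 1). The factor 2 counts the two halves of a bisected interval
    and (1/2)^mu is the gain on each, so [mu > 1] is what makes bisection contract. *)
Lemma powR_half_lt mu : 1 < mu -> 2 * (2^-1 : R) `^ mu < 1.
Proof.
move=> mu1; rewrite -mulr_powRB1 ?invr_ge0//; last exact: lt_trans mu1.
by rewrite mulrA divff// mul1r powR_half_lt1// subr_gt0.
Qed.

Lemma powR_sqr r gamma : (r `^ gamma) ^+ 2 = r `^ (2 * gamma).
Proof. by rewrite mulrC powRrM powR_mulrn// powR_ge0. Qed.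

End RealLemmas.

(** * Abstract calculus of increments twisted by a contraction semigroup *)

Section ConvolutionalYoung.
Variables (R : realType) (V : zmodType) (W Z : normedModType R).
Variables (N : V -> R) (S : R -> V -> V) (ell : V -> W) (X : R -> Z -> V).
Variables (gamma T K : R).
Hypotheses (gamma_gt : 1 / 2 < gamma) (T_gt0 : 0 < T) (K_ge0 : 0 <= K).
Hypotheses (N0 : N 0 = 0) (NN : forall v, N (- v) = N v).
Hypothesis ND : forall u v, N (u + v) <= N u + N v.
(** [N] is only a seminorm on a bare group, so completeness is phrased as existence of some limit,
    with an explicit rate, for geometrically small increments. *)
Hypothesis N_complete : forall (v : nat -> V) (C q : R), 0 <= q < 1 ->
  (forall n, N (v n.+1 - v n) <= C * q ^+ n) ->
  exists v', forall n, N (v n - v') <= C / (1 - q) * q ^+ n.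
Hypothesis SB : forall t u v, S t (u - v) = S t u - S t v.
Hypothesis S_contract : forall t v, 0 <= t -> N (S t v) <= N v.
Hypothesis S_add : forall s t v, 0 <= s -> 0 <= t -> S s (S t v) = S (s + t) v.
Hypothesis S0 : forall v, S 0 v = v.
Hypothesis ellB : forall u v, ell (u - v) = ell u - ell v.
Hypothesis ell_le : forall v, `|ell v| <= N v.
Hypothesis ell_S : forall t v, 0 <= t -> `|ell (v - S t v)| <= t `^ gamma * N v.
Hypothesis XB : forall t z z', X t (z - z') = X t z - X t z'.

(* dl is the paper's tilde-delta on paths and dx t s z stands for x1_ts z. *)
Definition dl (y : R -> V) t s := y t - S (t - s) (y s).
Definition dx t s z := dl (fun r => X r z) t s.

Hypothesis dx_le : forall t s z, 0 <= s -> s <= t -> t <= T ->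
  N (dx t s z) <= K * (t - s) `^ gamma * `|z|.

Let theta : R := 2^-1 `^ gamma.
Local Notation p r := (r `^ gamma).

(* The constant of the sewing bound: the fixed point of the error recursion produced by
   one bisection. *)
Variable csew : R.
Hypothesis csew_ge0 : 0 <= csew.
Hypothesis csew_fix : 2 * theta ^+ 2 * csew + theta ^+ 2 = csew.

Lemma gamma_gt0 : 0 < gamma. Proof. by apply: lt_trans gamma_gt; lra. Qed.

Lemma theta_gt0 : 0 < theta. Proof. by rewrite powR_gt0// invr_gt0. Qed.

Lemma theta_lt1 : theta < 1. Proof. exact/powR_half_lt1/gamma_gt0. Qed.

Lemma theta2_lt : 2 * theta ^+ 2 < 1.
Proof. by rewrite powR_sqr powR_half_lt//; move: gamma_gt; lra. Qed.

Lemma powR_gamma_le a b : 0 <= a -> a <= b -> p a <= p b.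
Proof.
move=> a0 ab; apply: ge0_ler_powR; rewrite ?nnegrE ?(ltW gamma_gt0)//.
exact: le_trans ab.
Qed.

Lemma powR_gamma0 : p 0 = 0 :> R. Proof. by rewrite powR0// gt_eqF// gamma_gt0. Qed.

Lemma N_ge0 v : 0 <= N v.
Proof. by have := ND v (- v); rewrite subrr N0 NN; lra. Qed.

Lemma NB u v : N (u - v) <= N u + N v.
Proof. by rewrite -(NN v) ND. Qed.

Lemma N_sub u v : N u <= N v + N (u - v).
Proof. by apply: le_trans (ND _ _); rewrite addrC subrK. Qed.

Lemma S_0 t : S t 0 = 0.
Proof. by have := SB t 0 0; rewrite !subrr. Qed.

Lemma SN t v : S t (- v) = - S t v.
Proof. by rewrite -sub0r SB S_0 sub0r. Qed.

Lemma SD t u v : S t (u + v) = S t u + S t v.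
Proof. by rewrite -{1}(opprK v) SB SN opprK. Qed.

Lemma dlB y y' t s : dl (fun r => y r - y' r) t s = dl y t s - dl y' t s.
Proof. by rewrite /dl SB !opprD !opprK addrACA. Qed.

Lemma dl_id y t : dl y t t = 0.
Proof. by rewrite /dl subrr S0 subrr. Qed.

Lemma dlE y t s : y t = dl y t s + S (t - s) (y s).
Proof. by rewrite /dl subrK. Qed.

Lemma dl_chasles y t u s : s <= u -> u <= t ->
  dl y t s = dl y t u + S (t - u) (dl y u s).
Proof.
move=> su ut; rewrite /dl SB S_add ?subr_ge0// addrA subrK.
by congr (_ - S _ _); lra.
Qed.

Lemma dxB t s z z' : dx t s (z - z') = dx t s z - dx t s z'.
Proof. by rewrite /dx -dlB; congr dl; apply: funext => r; exact: XB. Qed.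

Lemma dx_chasles t u s z : s <= u -> u <= t ->
  dx t s z = dx t u z + S (t - u) (dx u s z).
Proof. exact: dl_chasles. Qed.

Lemma N_dl_le y t s : s <= t -> N (y t) <= N (dl y t s) + N (y s).
Proof.
move=> st; rewrite {1}(dlE y t s); apply: le_trans (ND _ _) _.
by rewrite lerD2l S_contract// subr_ge0.
Qed.

Lemma dl_le y t s : s <= t -> N (dl y t s) <= N (y t) + N (y s).
Proof.
by move=> st; apply: le_trans (NB _ _) _; rewrite lerD2l S_contract// subr_ge0.
Qed.

(** Both times are compared with a common earlier time [u]. The last term involves the single vector
    [y u], so continuity of the semigroup at one vector suffices, without uniformity along the
    path. *)
Lemma N_incr_le y u a b : u <= a -> a <= b ->
  N (y b - y a) <= N (dl y b u) + N (dl y a u) + N (y u - S (b - a) (y u)).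
Proof.
move=> ua ab.
have -> : y b - y a = dl y b u - dl y a u - S (a - u) (y u - S (b - a) (y u)).
  rewrite SB S_add ?subr_ge0// (_ : a - u + (b - a) = b - u); last by ring.
  by rewrite /dl !opprB [RHS]addrAC !subrKA.
apply: le_trans (NB _ _) _; apply: lerD; first exact: NB.
by rewrite S_contract// subr_ge0.
Qed.

(** An ordinary increment is the twisted one minus [y s - S (t - s) (y s)]. No rate in [N] is
    assumed for the latter, but [ell_S] provides one after applying [ell]. *)
Lemma ell_incr y t s : s <= t ->
  `|ell (y t) - ell (y s)| <= N (dl y t s) + p (t - s) * N (y s).
Proof.
move=> st; rewrite -ellB.
have -> : y t - y s = dl y t s - (y s - S (t - s) (y s)).
  by rewrite /dl opprB addrA subrK.
rewrite ellB; apply: le_trans (ler_normB _ _) _; apply: lerD; first exact: ell_le.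
by apply: ell_S; rewrite subr_ge0.
Qed.

(** Path and integrand are independent: in a Picard step [w] is the new iterate while [z] comes from
    the previous one; for a solution [z] comes from [w] itself. *)
Definition young_rem (w : R -> V) (z : R -> Z) t s := dl w t s - dx t s (z s).

Lemma young_remB w w' z z' t s :
  young_rem (fun r => w r - w' r) (fun r => z r - z' r) t s =
  young_rem w z t s - young_rem w' z' t s.
Proof. by rewrite /young_rem dlB dxB !opprD !opprK addrACA. Qed.

(** [dl] and [dx] both satisfy Chasles' relation. What survives is the replacement, on [u, t], of
    the integrand frozen at [s] by the one frozen at [u]. *)
Lemma young_rem_chasles w z t u s : s <= u -> u <= t ->
  young_rem w z t s = young_rem w z t u + S (t - u) (young_rem w z u s) + dx t u (z u - z s).
Proof.
move=> su ut; rewrite /young_rem (dl_chasles _ su ut) (dx_chasles _ su ut) dxB.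
rewrite (SB _ (dl w u s)); set a := dl w t u; set b := S _ (dl w u s); set c := dx t u (z s).
set c' := S _ (dx u s _); set e := dx t u (z u).
move: a b c c' e => a b c c' e; rewrite opprD !addrA [LHS]addrAC; congr (_ - _).
rewrite [RHS]addrAC; congr (_ - _).
by rewrite [RHS]addrAC subrK.
Qed.

Lemma N_young_rem_chasles w z t u s : 0 <= s -> s <= u -> u <= t -> t <= T ->
  N (young_rem w z t s) <=
    N (young_rem w z t u) + N (young_rem w z u s) + K * p (t - u) * `|z u - z s|.
Proof.
move=> s0 su ut tT; rewrite (young_rem_chasles _ _ su ut).
apply: le_trans (ND _ _) _; apply: lerD; last by apply: dx_le => //; exact: le_trans su.
by apply: le_trans (ND _ _) _; rewrite lerD2l S_contract// subr_ge0.
Qed.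

(* Each midpoint bisection contracts the a priori bound by 2^(1-mu) < 1, so only the
   fixed point csew of the accumulated errors survives in the limit. *)
Lemma sewing_bound (w : R -> V) (z : R -> Z) (wt : R -> R) (tau mu C H : R) :
  1 < mu -> 0 <= H -> {homo wt : a b / a <= b} -> (forall r, 0 <= wt r) ->
  (forall t s, 0 <= s -> s <= t -> t <= T -> t - s <= tau ->
     `|z t - z s| <= H * wt t * p (t - s)) ->
  (forall t s, 0 <= s -> s <= t -> t <= T -> t - s <= tau ->
     N (young_rem w z t s) <= C * (t - s) `^ mu) ->
  forall t s, 0 <= s -> s <= t -> t <= T -> t - s <= tau ->
     N (young_rem w z t s) <= csew * K * H * wt t * p (t - s) ^+ 2.
Proof.
move=> mu1 H0 wt_le wt0 zH rC.
pose kap : R := 2^-1 `^ mu.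
have kap0 : 0 <= 2 * kap by rewrite mulr_ge0// powR_ge0.
have kap1 : 2 * kap < 1 by exact: powR_half_lt.
have C0 : forall t s, 0 <= s -> s < t -> t <= T -> t - s <= tau -> 0 <= C.
  move=> t s s0 st tT ts; have := le_trans (N_ge0 _) (rC t s s0 (ltW st) tT ts).
  by rewrite pmulr_lge0// powR_gt0// subr_gt0.
suff main : forall n t s, 0 <= s -> s <= t -> t <= T -> t - s <= tau ->
    N (young_rem w z t s) <= C * (2 * kap) ^+ n * (t - s) `^ mu
                       + csew * K * H * wt t * p (t - s) ^+ 2.
  move=> t s s0 st tT ts.
  apply: (@le_expr_limit _ (2 * kap) (C * (t - s) `^ mu)) => [|n]; first exact/andP.
  by rewrite addrC mulrAC; exact: main.
elim=> [|n IH] t s s0 st tT ts.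
  rewrite expr0 mulr1; apply: le_trans (rC _ _ s0 st tT ts) _.
  by rewrite lerDl !mulr_ge0// powR_ge0.
pose u := (s + t) / 2.
have su : s <= u by rewrite /u; lra.
have ut : u <= t by rewrite /u; lra.
have tu : t - u = (t - s) / 2 by rewrite /u; field.
have us : u - s = (t - s) / 2 by rewrite /u; field.
have ts0 : 0 <= t - s by rewrite subr_ge0.
have u0 : 0 <= u by exact: le_trans su.
have uT : u <= T by exact: le_trans tT.
have h1 : N (young_rem w z t u) <= _ := IH t u u0 ut tT ltac:(by rewrite tu; lra).
have h2 : N (young_rem w z u s) <= _ := IH u s s0 su uT ltac:(by rewrite us; lra).
have h3 := zH u s s0 su uT ltac:(by rewrite us; lra).
apply: le_trans (N_young_rem_chasles _ _ s0 su ut tT) _.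
move: h1 h2 h3; rewrite tu us !powR_half// -/theta -/kap.
have := wt_le u t ut.
set a := `|z u - z s|; set r := p (t - s); set rm := (t - s) `^ mu => wtu h1 h2 h3.
have r0 : 0 <= r by exact: powR_ge0.
have th0 := ltW theta_gt0.
(* Monotonicity replaces the weight at the midpoint by the one at [t], so that both halves are
   measured alike. *)
have kw : csew * K * H * wt u * (theta * r) ^+ 2 <= csew * K * H * wt t * (theta * r) ^+ 2.
  by rewrite ler_wpM2r ?sqr_ge0// ler_wpM2l// !mulr_ge0//.
have k3 : K * (theta * r) * a <= K * H * wt t * (theta * r) ^+ 2.
  apply: (@le_trans _ _ (K * (theta * r) * (H * wt t * (theta * r)))).
    apply: ler_wpM2l; first by rewrite !mulr_ge0.
    by apply: le_trans h3 _; apply: ler_wpM2r; [rewrite mulr_ge0|rewrite ler_wpM2l].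
  by rewrite le_eqVlt; apply/orP; left; apply/eqP; ring.
(* Two halves at scale [theta * r] plus the defect of one cut: [csew_fix] says that they reproduce
   [csew]. *)
have e : csew * K * H * wt t * r ^+ 2 =
   2 * (csew * K * H * wt t * (theta * r) ^+ 2) + K * H * wt t * (theta * r) ^+ 2.
  by rewrite -[in LHS]csew_fix; ring.
rewrite e exprS.
have -> : C * (2 * kap * (2 * kap) ^+ n) * rm = 2 * (C * (2 * kap) ^+ n * (kap * rm)) by ring.
move: h1 h2 kw k3; lra.
Qed.

Lemma dx_id t z : dx t t z = 0. Proof. exact: dl_id. Qed.

Lemma young_rem_id w z t : young_rem w z t t = 0.
Proof. by rewrite /young_rem dl_id dx_id subrr. Qed.

(** * Convolutional integrals as limits over dyadic grids *)

(** An exponential Euler scheme with prescribed integrand [z], evaluated at the left end of each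
    cell. *)
Fixpoint grid_value (z : R -> Z) (h : R) (i : nat) : V :=
  if i is j.+1 then S h (grid_value z h j) + dx (j.+1%:R * h) (j%:R * h) (z (j%:R * h))
  else 0.

(* The convolutional integral of the integrand frozen at the left point of each cell of
   the grid of mesh h. *)
Lemma frozen_integral (z : R -> Z) h : 0 < h -> exists2 Y : R -> V, Y 0 = 0 &
  forall i t s, i%:R * h <= s -> s <= t -> t <= i.+1%:R * h ->
    dl Y t s = dx t s (z (i%:R * h)).
Proof.
move=> h0; pose v := grid_value z h.
pose cell i t := S (t - i%:R * h) (v i) + dx t (i%:R * h) (z (i%:R * h)).
have cell_l i : cell i (i%:R * h) = v i by rewrite /cell subrr S0 dx_id addr0.
have cell_r i : cell i (i.+1%:R * h) = v i.+1.
  by rewrite /cell; congr (S _ _ + _); rewrite -natr1; ring.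
pose Y t := cell (Num.truncn (t / h)) t.
(* [Num.truncn] assigns a grid point to the cell on its right; by [cell_l] and [cell_r] the cell on
   its left gives the same value, so closed cells are allowed. *)
have YE i t : i%:R * h <= t -> t <= i.+1%:R * h -> Y t = cell i t.
  move=> it; rewrite le_eqVlt => /predU1P[->|ti]; rewrite /Y.
    by rewrite mulfK ?gt_eqF// natrK cell_l cell_r.
  congr cell; apply/eqP; rewrite truncn_eq; last first.
    by rewrite divr_ge0// ?(ltW h0)// (le_trans _ it)// mulr_ge0// ltW.
  by rewrite ler_pdivlMr// it ltr_pdivrMr.
exists Y => [|i t s is_ st ti].
  have := cell_l 0%N; rewrite mul0r => c0; rewrite -[RHS]c0; apply: YE; rewrite ?mul0r ?mul1r//.
  exact: ltW.
rewrite /dl (YE i)// ?(le_trans is_)// (YE i s)// ?(le_trans st)//.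
rewrite /cell SD S_add ?subr_ge0// (dx_chasles _ is_ st) subrKA.
set a := S _ (dx s _ _); set b := dx t s _.
have -> : t - i%:R * h = t - s + (s - i%:R * h) by ring.
by rewrite opprD addrACA subrr add0r addrK.
Qed.

Section Sewing.
Variables (z : R -> Z) (H : R).
Hypothesis H_ge0 : 0 <= H.
Hypothesis z_hoelder : forall t s, 0 <= s -> s <= t -> t <= T ->
  `|z t - z s| <= H * p (t - s).

(** Halving the mesh changes the integrand only on the right half of each cell, from z(ih) to z(ih +
    h/2), at a cost of at most K H p(h)^2. Since [S] contracts, the errors of successive cells just
    add up. *)
Lemma frozen_refine h (Y Y' : R -> V) : 0 < h -> Y 0 = 0 -> Y' 0 = 0 ->
  (forall i t s, i%:R * h <= s -> s <= t -> t <= i.+1%:R * h ->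
    dl Y t s = dx t s (z (i%:R * h))) ->
  (forall i t s, i%:R * (h / 2) <= s -> s <= t -> t <= i.+1%:R * (h / 2) ->
    dl Y' t s = dx t s (z (i%:R * (h / 2)))) ->
  forall i t, i%:R * h <= t -> t <= i.+1%:R * h -> t <= T ->
    N (Y' t - Y t) <= i.+1%:R * (K * H * p h ^+ 2).
Proof.
move=> h0 Y0 Y'0 dY dY'; set E := K * H * _.
have E0 : 0 <= E by rewrite /E !mulr_ge0// powR_ge0.
suff step i t : i%:R * h <= t -> t <= i.+1%:R * h -> t <= T ->
    N (dl (fun r => Y' r - Y r) t (i%:R * h)) <= E.
  elim=> [|i IH] t it ti tT.
    apply: le_trans (N_dl_le (fun r => Y' r - Y r) it) _.
    rewrite mul0r Y0 Y'0 subrr N0 addr0 mul1r.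
    by have := step 0%N t it ti tT; rewrite mul0r.
  apply: le_trans (N_dl_le (fun r => Y' r - Y r) it) _.
  rewrite -[i.+2%:R]natr1 mulrDl mul1r addrC; apply: lerD; last exact: step.
  by apply: IH => //; [rewrite ler_wpM2r ?ler_nat// ltW|exact: le_trans tT].
move=> it ti tT.
have e0 : (2 * i)%:R * (h / 2) = i%:R * h by rewrite natrM; field.
have e2 : (2 * i).+2%:R * (h / 2) = i.+1%:R * h.
  by rewrite -!natr1 natrM; field.
have i0 : 0 <= i%:R * h by rewrite mulr_ge0// ltW.
pose u := (2 * i).+1%:R * (h / 2).
have iu : u - i%:R * h = h / 2 by rewrite /u -natr1 natrM; field.
have uh : i.+1%:R * h - u = h / 2 by rewrite /u -!natr1 natrM; field.
rewrite dlB (dY i t _ (lexx _) it ti).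
(* Up to the midpoint [u] both grids freeze at the same point; beyond it, Chasles' relation at [u]
   isolates the term in [z u - z (i%:R * h)]. *)
have [tu|/ltW ut] := leP t u.
  by rewrite (dY' (2 * i)%N)// e0// subrr N0.
have iu' : i%:R * h <= u by rewrite -subr_ge0 iu; lra.
rewrite (dl_chasles Y' iu' ut) (dY' (2 * i).+1)// ?e2//.
rewrite (dY' (2 * i)%N u)// ?e0// (dx_chasles _ iu' ut).
rewrite opprD addrACA subrr addr0 -dxB -/u.
apply: le_trans (dx_le _ (le_trans i0 iu') ut tT) _.
have ph a : 0 <= a -> a <= h / 2 -> p a <= p h by move=> ? ?; apply: powR_gamma_le => //; lra.
have h1 : p (t - u) <= p h by apply: ph; [rewrite subr_ge0|move: uh; lra].
have h2 : `|z u - z (i%:R * h)| <= H * p h.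
  apply: le_trans (z_hoelder i0 iu' (le_trans ut tT)) _.
  by rewrite ler_wpM2l//; apply: ph; rewrite iu//; lra.
apply: (@le_trans _ _ (K * p h * (H * p h))).
  by apply: ler_pM => //; rewrite ?mulr_ge0 ?powR_ge0// ler_wpM2l.
by rewrite le_eqVlt; apply/orP; left; apply/eqP; rewrite /E; ring.
Qed.

(** An interval of length at most [h] meets at most two cells. Within one cell the remainder is [dx]
    of a difference of [z]; across a grid point, the part after it has zero remainder and the cut
    adds one defect. Hence the factor 2. *)
Lemma frozen_rem h (Y : R -> V) : 0 < h ->
  (forall i t s, i%:R * h <= s -> s <= t -> t <= i.+1%:R * h ->
    dl Y t s = dx t s (z (i%:R * h))) ->
  forall t s, 0 <= s -> s <= t -> t <= T -> t - s <= h ->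
    N (young_rem Y z t s) <= 2 * (K * H * p h ^+ 2).
Proof.
move=> h0 dY t s s0 st tT tsh; set E := K * H * _.
have E0 : 0 <= E by rewrite /E !mulr_ge0// powR_ge0.
have xE a b c : 0 <= c -> c <= b -> b <= a -> a <= T -> a - b <= h -> b - c <= h ->
    K * p (a - b) * `|z b - z c| <= E.
  move=> c0 cb ba aT ab bc.
  have h1 : p (a - b) <= p h by apply: powR_gamma_le => //; rewrite subr_ge0.
  have h2 : `|z b - z c| <= H * p h.
    apply: le_trans (z_hoelder c0 cb (le_trans ba aT)) _.
    by rewrite ler_wpM2l//; apply: powR_gamma_le; rewrite ?subr_ge0.
  apply: (@le_trans _ _ (K * p h * (H * p h))).
    by apply: ler_pM => //; rewrite ?mulr_ge0 ?powR_ge0// ler_wpM2l.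
  by rewrite le_eqVlt; apply/orP; left; apply/eqP; rewrite /E; ring.
pose i := Num.truncn (s / h).
have /andP[is_ si] : i%:R * h <= s < i.+1%:R * h.
  rewrite -ler_pdivlMr// -ltr_pdivrMr//.
  by rewrite truncn_itv// divr_ge0// ltW.
have i0 : 0 <= i%:R * h by rewrite mulr_ge0// ltW.
have ih : i.+1%:R * h = i%:R * h + h by rewrite -natr1; ring.
have ih2 : i.+2%:R * h = i.+1%:R * h + h by rewrite -[i.+2%:R]natr1; ring.
have one b : s <= b -> b <= i.+1%:R * h -> b <= T -> N (young_rem Y z b s) <= E.
  move=> sb bi bT; rewrite /young_rem (dY i)// -dxB.
  apply: le_trans (dx_le _ s0 sb bT) _; rewrite distrC.
  by apply: xE => //; move: bi; rewrite ih; lra.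
have [ti|/ltW it] := leP t (i.+1%:R * h).
  by apply: le_trans (one t st ti tT) _; lra.
apply: le_trans (N_young_rem_chasles _ _ s0 (ltW si) it tT) _.
rewrite {1}/young_rem (dY i.+1)//; last by rewrite ih2; move: tsh si; lra.
rewrite subrr N0 add0r (_ : 2 * E = E + E); last by ring.
apply: lerD.
  by apply: one => //; [exact: ltW|exact: le_trans tT].
by apply: xE => //; [exact: ltW|move: tsh si; lra|rewrite ih; move: is_; lra].
Qed.

(** Inside a cell the remainder of a frozen integral is only known to be of order gamma in [t - s],
    too low for [sewing_bound]. The recursion climbs from the mesh by doubling instead. It preserves
    the constant: 2 theta^2 (2 + csew) + theta^2 = 4 theta^2 + csew, and 2 theta^2 < 1. *)
Lemma frozen_rem_scale h (Y : R -> V) : 0 < h ->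
  (forall i t s, i%:R * h <= s -> s <= t -> t <= i.+1%:R * h ->
    dl Y t s = dx t s (z (i%:R * h))) ->
  forall k t s, 0 <= s -> s <= t -> t <= T -> t - s <= 2 ^+ k * h ->
    N (young_rem Y z t s) <= (2 + csew) * (K * H) * p (2 ^+ k * h) ^+ 2.
Proof.
move=> h0 dY; have KH : 0 <= K * H by rewrite mulr_ge0.
elim=> [|k IH] t s s0 st tT tsh.
  rewrite expr0 mul1r; rewrite expr0 mul1r in tsh.
  apply: le_trans (frozen_rem h0 dY s0 st tT tsh) _.
  rewrite mulrA; apply: ler_wpM2r; first by rewrite exprn_ge0// powR_ge0.
  by apply: ler_wpM2r => //; rewrite lerDl.
pose u := (s + t) / 2.
have su : s <= u by rewrite /u; lra.
have ut : u <= t by rewrite /u; lra.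
have tu : t - u = (t - s) / 2 by rewrite /u; field.
have us : u - s = (t - s) / 2 by rewrite /u; field.
have u0 : 0 <= u by exact: le_trans su.
have uT : u <= T by exact: le_trans tT.
set r := 2 ^+ k.+1 * h in tsh *.
have rE : 2 ^+ k * h = r / 2 by rewrite /r exprS; field.
have r0 : 0 <= r by rewrite /r mulr_ge0// ?exprn_ge0// ltW.
move: IH; rewrite rE powR_half// -/theta => IH.
have b1 := IH t u u0 ut tT ltac:(by rewrite tu; lra).
have b2 := IH u s s0 su uT ltac:(by rewrite us; lra).
have tr a : 0 <= a -> a <= r / 2 -> p a <= theta * p r.
  by move=> a0 ar; rewrite -powR_half// powR_gamma_le.
have b3 : K * p (t - u) * `|z u - z s| <= K * H * (theta * p r) ^+ 2.
  apply: (@le_trans _ _ (K * (theta * p r) * (H * (theta * p r)))); last first.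
    by rewrite le_eqVlt; apply/orP; left; apply/eqP; ring.
  apply: ler_pM => //; rewrite ?mulr_ge0 ?powR_ge0//.
    by rewrite ler_wpM2l// tr// ?subr_ge0// tu; lra.
  apply: le_trans (z_hoelder s0 su uT) _.
  by rewrite ler_wpM2l// tr// ?subr_ge0// us; lra.
apply: le_trans (N_young_rem_chasles _ _ s0 su ut tT) _.
apply: le_trans (lerD (lerD b1 b2) b3) _.
have -> : (2 + csew) * (K * H) * (theta * p r) ^+ 2 + (2 + csew) * (K * H) * (theta * p r) ^+ 2
  + K * H * (theta * p r) ^+ 2
  = (4 * theta ^+ 2 + (2 * theta ^+ 2 * csew + theta ^+ 2)) * (K * H * p r ^+ 2) by ring.
rewrite csew_fix -(mulrA (2 + csew)); apply: ler_wpM2r.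
  by rewrite mulr_ge0// exprn_ge0// powR_ge0.
by move: theta2_lt; lra.
Qed.

Lemma dyadic_scale r : 0 < r -> r <= T -> exists j, r <= T / 2 ^+ j <= 2 * r.
Proof.
move=> r0 rT.
have ex : exists n, T / 2 ^+ n <= 2 * r.
  have e0 : 0 < 2 * r / T by rewrite divr_gt0// mulr_gt0.
  have [|n hn] := @expr_small R 2^-1 _ _ e0; first by rewrite invr_ge0; lra.
  by exists n; move: hn; rewrite exprVn ler_pdivlMr// mulrC.
case: (ex_minnP ex) => -[|j] jT jmin; [exists 0%N|exists j.+1]; rewrite jT andbT.
  by rewrite expr0 divr1.
have : ~~ (T / 2 ^+ j <= 2 * r) by apply/negP => /jmin; rewrite ltnn.
rewrite -ltNge => h; rewrite exprS invfM mulrCA mulrC.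
by move: h; set a := T / _; lra.
Qed.

Lemma powR_gamma_dyadic r n : 0 <= r -> p (r / 2 ^+ n) = theta ^+ n * p r.
Proof.
move=> r0; elim: n => [|n IH]; first by rewrite !expr0 divr1 mul1r.
have -> : r / 2 ^+ n.+1 = r / 2 ^+ n / 2 by rewrite exprS; field; rewrite expf_neq0.
by rewrite powR_half ?IH -/theta ?exprS ?mulrA// divr_ge0// exprn_ge0.
Qed.

Lemma sewing_exists : exists (Y : R -> V) (C : R), N (Y 0) = 0 /\
  forall t s, 0 <= s -> s <= t -> t <= T -> N (young_rem Y z t s) <= C * p (t - s) ^+ 2.
Proof.
pose h n : R := T / 2 ^+ n.
have h0 n : 0 < h n by rewrite divr_gt0// exprn_gt0.
have /choice[Yn hY] : forall n, exists Y : R -> V, Y 0 = 0 /\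
    forall i t s, i%:R * h n <= s -> s <= t -> t <= i.+1%:R * h n ->
    dl Y t s = dx t s (z (i%:R * h n)).
  move=> n; have [Y Y0 dY] := frozen_integral z (h0 n).
  by exists Y.
(* At level n at most 2^n + 1 <= 2 * 2^n cells are involved, each with error K H p(T)^2 theta^(2n).
   This gives the ratio [q] and the 2 in [A]. *)
pose q := 2 * theta ^+ 2; pose A := 2 * (K * H) * p T ^+ 2.
have q0 : 0 <= q by rewrite mulr_ge0// sqr_ge0.
have q01 : 0 <= q < 1 by rewrite q0 theta2_lt.
have KH : 0 <= K * H by rewrite mulr_ge0.
have inc n t : 0 <= t -> t <= T -> N (Yn n.+1 t - Yn n t) <= A * q ^+ n.
  move=> t0 tT.
  have [Y0 dY] := hY n; have [Y'0] := hY n.+1.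
  have -> : h n.+1 = h n / 2 by rewrite /h exprS; field; rewrite expf_neq0.
  move=> dY'.
  pose i := Num.truncn (t / h n).
  have th0 : 0 <= t / h n by rewrite divr_ge0// ltW.
  have /andP[it ti] : i%:R * h n <= t < i.+1%:R * h n.
    by rewrite -ler_pdivlMr// -ltr_pdivrMr// truncn_itv.
  apply: le_trans (frozen_refine (h0 n) Y0 Y'0 dY dY' it (ltW ti) tT) _.
  have i2 : i%:R <= 2 ^+ n :> R.
    apply: (@le_trans _ _ (t / h n)); first by rewrite ler_pdivlMr.
    rewrite ler_pdivrMr// /h mulrC divfK// ?expf_neq0//.
  have -> : A * q ^+ n = (2 * 2 ^+ n) * (K * H * p (h n) ^+ 2).
    by rewrite /A /q exprMn (exprAC theta) /h powR_gamma_dyadic ?(ltW T_gt0)//; ring.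
  apply: ler_wpM2r; first by rewrite mulr_ge0// exprn_ge0// powR_ge0.
  have : 1 <= 2 ^+ n :> R by rewrite exprn_ege1// ler1n.
  by rewrite -natr1; move: i2; lra.
have /choice[Y YP] : forall t, exists v, 0 <= t -> t <= T ->
    forall n, N (Yn n t - v) <= A / (1 - q) * q ^+ n.
  move=> t.
  have [/andP[t0 tT]|tn] := boolP (0 <= t <= T); last first.
    by exists 0 => t0 tT; rewrite t0 tT in tn.
  have [v hv] := N_complete q01 (fun n => inc n t t0 tT).
  by exists v.
set B := A / (1 - q) in YP.
have qn0 n : 0 <= q ^+ n by rewrite exprn_ge0.
have B0 : 0 <= B.
  have := le_trans (N_ge0 _) (YP 0 (lexx _) (ltW T_gt0) 0%N).
  by rewrite expr0 mulr1.
(* A length [t - s] is enlarged to a dyadic fraction of [T] at most twice as long, which costs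
   theta^(-2). *)
exists Y, ((2 + csew) * (K * H) / theta ^+ 2); split.
  apply/eqP; rewrite eq_le N_ge0 andbT; apply: (@le_expr_limit _ q B) => // n.
  have [Y0 _] := hY n.
  by have := YP 0 (lexx _) (ltW T_gt0) n; rewrite Y0 sub0r NN add0r.
move=> t s s0; rewrite le_eqVlt => /predU1P[<- tT|st tT].
  by rewrite young_rem_id N0 subrr powR_gamma0 expr0n mulr0.
have ts0 : 0 < t - s by rewrite subr_gt0.
have [|j /andP[j1 j2]] := dyadic_scale ts0; first lra.
have [t0 sT] : 0 <= t /\ s <= T by split; lra.
apply: (@le_trans _ _ ((2 + csew) * (K * H) * p (T / 2 ^+ j) ^+ 2)).
  (* The scale T / 2^j stays fixed while the mesh T / 2^(j + k) tends to 0; at that scale the bound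
     of [frozen_rem_scale] does not depend on [k]. *)
  apply: (@le_expr_limit _ q (B * q ^+ j + B * q ^+ j)) => // k.
  have [_ dY] := hY (j + k)%N.
  have e : 2 ^+ k * h (j + k)%N = T / 2 ^+ j.
    by rewrite /h exprD; field; rewrite !expf_neq0.
  have := frozen_rem_scale (h0 (j + k)%N) dY (k := k) s0 (ltW st) tT.
  rewrite e => /(_ j1) hr.
  apply: le_trans (N_sub _ (young_rem (Yn (j + k)%N) z t s)) _; apply: lerD hr _.
  have -> : young_rem Y z t s - young_rem (Yn (j + k)%N) z t s =
      dl (fun r => Y r - Yn (j + k)%N r) t s.
    by rewrite dlB /young_rem opprB subrKA.
  apply: le_trans (dl_le _ (ltW st)) _.
  have := YP t t0 tT (j + k)%N; have := YP s s0 sT (j + k)%N.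
  rewrite -[N (_ - Y s)]NN -[N (_ - Y t)]NN !opprB exprD mulrA.
  by rewrite mulrDl => ? ?; exact: lerD.
rewrite -(mulrA _ (theta ^- 2)); apply: ler_wpM2l.
  by rewrite mulr_ge0// addr_ge0 ?csew_ge0.
have -> : theta ^- 2 * p (t - s) ^+ 2 = p (2 * (t - s)) ^+ 2.
  have -> : p (t - s) = theta * p (2 * (t - s)).
    by rewrite -powR_half ?mulr_ge0 ?ltW//; congr powR; field.
  by field; rewrite gt_eqF// theta_gt0.
have Tj : 0 <= T / 2 ^+ j by rewrite ltW// -/(h j).
by rewrite lerXn2r ?nnegrE ?powR_ge0// powR_gamma_le.
Qed.

End Sewing.

(** * Picard iteration and uniqueness in the abstract setting *)

Section Picard.
Variables (F : W -> Z) (C0 C1 C2 : R).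
Hypotheses (C0_ge0 : 0 <= C0) (C1_ge0 : 0 <= C1) (C2_ge0 : 0 <= C2).
Hypothesis F_le : forall a, `|F a| <= C0.
Hypothesis F_lip : forall a b, `|F a - F b| <= C1 * `|a - b|.
Hypothesis F_lip2 : forall a b v,
  `|F (a + v) - F a - (F (b + v) - F b)| <= C2 * `|v| * `|a - b|.

Local Notation Fell y := (fun r => F (ell (y r))).

(** A discrete Gronwall argument: stepping back from [t] by [tau] until time 0, each step adds one
    increment because [S] contracts. The majorant [B] leaves open how they are summed: geometrically
    with the weight, linearly without. *)
Lemma chain_bound (y : R -> V) (g B : R -> R) tau : 0 < tau -> N (y 0) = 0 ->
  (forall t, 0 <= g t) ->
  (forall t s, 0 <= s -> s <= t -> t <= T -> t - s <= tau ->
     N (dl y t s) <= g t * p (t - s)) ->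
  (forall t, 0 <= t -> g t * p tau <= B t) ->
  (forall t, tau <= t -> g t * p tau + B (t - tau) <= B t) ->
  forall t, 0 <= t -> t <= T -> N (y t) <= B t.
Proof.
move=> tau0 y0 g0 dy B1 B2 t t0.
have [n tn] : exists n : nat, t <= n%:R * tau.
  exists (Num.truncn (t / tau)).+1; rewrite -ler_pdivrMr//.
  by have /andP[_ /ltW] := truncn_itv (divr_ge0 t0 (ltW tau0)).
have short r : 0 <= r -> r <= tau -> r <= T -> N (y r) <= B r.
  move=> r0 rtau rT; apply: le_trans (N_dl_le y r0) _; rewrite y0 addr0.
  apply: le_trans (dy _ _ (lexx _) r0 rT _) _; first by rewrite subr0.
  by apply: le_trans (B1 _ r0); rewrite subr0 ler_wpM2l// powR_gamma_le.
elim: n t t0 tn => [|n IH] t t0 tn tT.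
  by apply: short => //; apply: le_trans tn _; rewrite mul0r ltW.
have [ttau|/ltW taut] := leP t tau; first exact: short.
have tt : t - tau <= t by rewrite gerBl ltW.
have ttau0 : 0 <= t - tau by rewrite subr_ge0.
apply: le_trans (N_dl_le y tt) _; apply: le_trans (B2 _ taut).
have e : t - (t - tau) = tau by ring.
apply: lerD; first by rewrite -[in leRHS]e dy// e.
apply: IH => //; last exact: le_trans tT.
by rewrite lerBlDr; move: tn; rewrite -natr1 mulrDl mul1r.
Qed.

(* Shifting time by tau halves the weight, so summing increments over consecutive windows of
   length tau costs only a factor 2, uniformly in T. *)
Let wt tau (t : R) : R := 2 `^ (t / tau).

Lemma wt_shift tau t : 0 < tau -> wt tau (t - tau) = wt tau t / 2.
Proof.
move=> tau0; rewrite /wt mulrBl divff ?gt_eqF// powRB; last by apply/implyP.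
by rewrite powRr1.
Qed.

Lemma wt_homo tau : 0 < tau -> {homo wt tau : a b / a <= b}.
Proof.
move=> tau0 a b ab; rewrite /wt ler_powR// ?ler1n//.
by rewrite ler_pM2r// invr_gt0.
Qed.

Lemma wt_ge1 tau t : 0 < tau -> 0 <= t -> 1 <= wt tau t.
Proof.
move=> tau0 t0; rewrite -[leLHS](powRr0 2) /wt ler_powR ?ler1n//.
by rewrite divr_ge0// ltW.
Qed.

Lemma N_weighted (w : R -> V) tau A : 0 < tau -> 0 <= A -> N (w 0) = 0 ->
  (forall t s, 0 <= s -> s <= t -> t <= T -> t - s <= tau ->
     N (dl w t s) <= A * wt tau t * p (t - s)) ->
  forall t, 0 <= t -> t <= T -> N (w t) <= 2 * A * p tau * wt tau t.
Proof.
move=> tau0 A0 w0 dw.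
have wt0 t : 0 <= wt tau t by exact: powR_ge0.
have pt0 : 0 <= p tau by exact: powR_ge0.
apply: (chain_bound tau0 w0 (g := fun t => A * wt tau t)) => // t.
- by rewrite mulr_ge0.
- move=> _; have : 0 <= A * p tau * wt tau t by rewrite !mulr_ge0.
  by lra.
- by move=> _; rewrite wt_shift// le_eqVlt; apply/orP; left; apply/eqP; field.
Qed.

(** The affine majorant counts the windows of length [tau]. This bound enters the Hoelder constant
    of [ell o y], which has to be uniform along the Picard iteration. *)
Lemma N_unweighted (y : R -> V) tau A : 0 < tau -> 0 <= A -> N (y 0) = 0 ->
  (forall t s, 0 <= s -> s <= t -> t <= T -> t - s <= tau ->
     N (dl y t s) <= A * p (t - s)) ->
  forall t, 0 <= t -> t <= T -> N (y t) <= A * p tau * (T / tau + 1).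
Proof.
move=> tau0 A0 y0 dy t t0 tT.
have pt0 : 0 <= p tau by exact: powR_ge0.
have Ap : 0 <= A * p tau by rewrite mulr_ge0.
apply: (@le_trans _ _ (A * p tau * (t / tau + 1))); last first.
  by rewrite ler_wpM2l// lerD2r ler_pM2r// invr_gt0.
apply: (chain_bound tau0 y0 (g := fun=> A) (B := fun r => A * p tau * (r / tau + 1)))
  => // r r0.
- by rewrite ler_peMr// lerDr divr_ge0// ltW.
- rewrite le_eqVlt; apply/orP; left; apply/eqP; field.
  by rewrite gt_eqF.
Qed.

Lemma Fell_lip (y : R -> V) tau A M :
  (forall t s, 0 <= s -> s <= t -> t <= T -> t - s <= tau ->
     N (dl y t s) <= A * p (t - s)) ->
  (forall t, 0 <= t -> t <= T -> N (y t) <= M) ->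
  forall t s, 0 <= s -> s <= t -> t <= T -> t - s <= tau ->
     `|ell (y t) - ell (y s)| <= (A + M) * p (t - s).
Proof.
move=> dy yM t s s0 st tT ts; apply: le_trans (ell_incr y st) _.
rewrite mulrDl (mulrC M); apply: lerD; first exact: dy.
by rewrite ler_wpM2l ?powR_ge0// yM// (le_trans st).
Qed.

(** The primed paths are Picard images of [y1] and [y2]; for uniqueness they are [y1] and [y2]
    themselves. In the smallness condition the first term pays for [dx] of the difference of
    integrands, the second for the sewing remainder. [C] only gives access to [sewing_bound] and
    does not reach the conclusion. *)
Lemma contraction (y1 y2 y1' y2' : R -> V) tau A Hy C :
  0 < tau -> p tau <= 1 -> 0 <= A -> 0 <= Hy ->
  2 * K * C1 * p tau + csew * K * p tau * (3 * C1 + 2 * C2 * (p tau * Hy)) <= 1 / 2 ->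
  N (y2 0 - y1 0) = 0 ->
  (forall t s, 0 <= s -> s <= t -> t <= T -> t - s <= tau ->
     `|ell (y1 t) - ell (y1 s)| <= Hy * p (t - s)) ->
  (forall t s, 0 <= s -> s <= t -> t <= T -> t - s <= tau ->
     N (dl (fun r => y2 r - y1 r) t s) <= A * wt tau t * p (t - s)) ->
  (forall t s, 0 <= s -> s <= t -> t <= T -> t - s <= tau ->
     N (young_rem y1' (Fell y1) t s) <= C * p (t - s) ^+ 2) ->
  (forall t s, 0 <= s -> s <= t -> t <= T -> t - s <= tau ->
     N (young_rem y2' (Fell y2) t s) <= C * p (t - s) ^+ 2) ->
  forall t s, 0 <= s -> s <= t -> t <= T -> t - s <= tau ->
     N (dl (fun r => y2' r - y1' r) t s) <= A / 2 * wt tau t * p (t - s).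
Proof.
move=> tau0 ptau1 A0 Hy0 small w0 y1H dw r1 r2.
pose w r := y2 r - y1 r; pose w' r := y2' r - y1' r.
pose ze r := F (ell (y2 r)) - F (ell (y1 r)).
have Nw : forall t, 0 <= t -> t <= T -> N (w t) <= 2 * A * p tau * wt tau t.
  exact: N_weighted.
have wt0 t : 0 <= wt tau t by exact: powR_ge0.
have pt0 : 0 <= p tau by exact: powR_ge0.
have ellw t : ell (y2 t) - ell (y1 t) = ell (w t) by rewrite /w ellB.
have zs s : 0 <= s -> s <= T -> `|ze s| <= C1 * (2 * A * p tau * wt tau s).
  move=> s0 sT; apply: le_trans (F_lip _ _) _; rewrite ler_wpM2l// ellw.
  by apply: le_trans (ell_le _) _; exact: Nw.
set Q := 3 * C1 + 2 * C2 * (p tau * Hy) in small.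
have Q0 : 0 <= Q by rewrite /Q !(addr_ge0, mulr_ge0).
have zH t s : 0 <= s -> s <= t -> t <= T -> t - s <= tau ->
    `|ze t - ze s| <= A * Q * wt tau t * p (t - s).
  move=> s0 st tT ts; have sT := le_trans st tT.
  have wst : wt tau s <= wt tau t by exact: wt_homo.
  pose a := ell (y1 t); pose b := ell (y1 s).
  have y2E r : ell (y2 r) = ell (y1 r) + ell (w r) by rewrite -ellw addrC subrK.
  (* First the shift [ell w] moves from [s] to [t] at a fixed base point; then the base point moves
     from [b] to [a] under a fixed shift. The latter is a second difference of [F] and brings in the
     Hoelder constant [Hy] of [y1]. *)
  have -> : ze t - ze s = (F (a + ell (w t)) - F (a + ell (w s))) +
     (F (a + ell (w s)) - F a - (F (b + ell (w s)) - F b)).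
    rewrite /ze !y2E -/a -/b.
    by rewrite -(addrA (F (a + ell (w s)))) subrKA addrA.
  apply: le_trans (ler_normD _ _) _.
  have pts0 : 0 <= p (t - s) by exact: powR_ge0.
  (* Here 3 = 1 + 2: one [A] from the twisted increment of [w], two from [N_weighted] with p(tau) <=
     1. *)
  have h1 : `|F (a + ell (w t)) - F (a + ell (w s))| <=
      C1 * (3 * A * wt tau t * p (t - s)).
    apply: le_trans (F_lip _ _) _; rewrite ler_wpM2l//.
    rewrite opprD addrACA subrr add0r.
    apply: le_trans (ell_incr w st) _.
    have e1 : N (dl w t s) <= A * wt tau t * p (t - s) by exact: dw.
    have e2 : p (t - s) * N (w s) <= p (t - s) * (2 * A * wt tau t).
      rewrite ler_wpM2l//; apply: le_trans (Nw s s0 sT) _.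
      rewrite -mulrA; apply: ler_wpM2l; first by rewrite mulr_ge0.
      by apply: le_trans wst; rewrite ler_piMl.
    by apply: le_trans (lerD e1 e2) _; lra.
  have h2 : `|F (a + ell (w s)) - F a - (F (b + ell (w s)) - F b)| <=
      C2 * (2 * A * p tau * wt tau t) * (Hy * p (t - s)).
    apply: le_trans (F_lip2 _ _ _) _; apply: ler_pM.
    - by rewrite mulr_ge0.
    - by [].
    - rewrite ler_wpM2l//; apply: le_trans (ell_le _) _.
      by apply: le_trans (Nw s s0 sT) _; rewrite ler_wpM2l// !mulr_ge0.
    - exact: y1H.
  apply: le_trans (lerD h1 h2) _.
  by rewrite le_eqVlt; apply/orP; left; apply/eqP; rewrite /Q; ring.
move=> t s s0 st tT ts.
have rw : N (young_rem w' ze t s) <= csew * K * (A * Q) * wt tau t * p (t - s) ^+ 2.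
  apply: (sewing_bound (tau := tau) (mu := 2 * gamma) (C := C + C)) => //.
  - by move: gamma_gt; lra.
  - by rewrite mulr_ge0.
  - exact: wt_homo.
  - move=> t' s' s'0 st' tT' ts'; rewrite -powR_sqr /w' /ze young_remB.
    apply: le_trans (NB _ _) _; rewrite mulrDl; apply: lerD; first exact: r2.
    exact: r1.
have sT := le_trans st tT.
have pts0 : 0 <= p (t - s) by exact: powR_ge0.
have ptst : p (t - s) <= p tau by rewrite powR_gamma_le// subr_ge0.
have dxz : N (dx t s (ze s)) <= K * p (t - s) * (C1 * (2 * A * p tau * wt tau t)).
  apply: le_trans (dx_le _ s0 st tT) _; rewrite ler_wpM2l// ?mulr_ge0//.
  apply: le_trans (zs s s0 sT) _; rewrite ler_wpM2l// ler_wpM2l// ?mulr_ge0//.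
  exact: wt_homo.
apply: le_trans (N_sub _ (dx t s (ze s))) _; apply: le_trans (lerD dxz rw) _.
have e1 : csew * K * (A * Q) * wt tau t * p (t - s) ^+ 2 <=
    csew * K * (A * Q) * wt tau t * p (t - s) * p tau.
  rewrite expr2 mulrA; apply: ler_wpM2l => //.
  by rewrite !mulr_ge0.
have e2 : A * wt tau t * p (t - s) *
    (2 * K * C1 * p tau + csew * K * p tau * Q) <= A * wt tau t * p (t - s) * (1 / 2).
  by apply: ler_wpM2l => //; rewrite !mulr_ge0.
move: e1 e2; lra.
Qed.

(** The last quantity is of order T tau^(2 gamma - 1). It is p(tau) times the bound of
    [N_unweighted], up to [A], so this product is small even if the bound itself is not. *)
Lemma small_window D : 0 < D -> exists tau, [/\ 0 < tau, p tau <= D &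
  p tau ^+ 2 * (T / tau + 1) <= D].
Proof.
move=> D0; have T1 : 0 < T + 1 by rewrite addr_gt0.
(* At tau = 2^(-n), the ratio theta governs p(tau) and 2 theta^2 governs tau^(2 gamma) / tau; [q]
   dominates both. *)
pose q := Num.max theta (2 * theta ^+ 2).
have th0 := ltW theta_gt0.
have q0 : 0 <= q by rewrite le_max th0.
have [|n qn] := @expr_small R q _ _ (divr_gt0 D0 T1).
  by rewrite q0 gt_max theta_lt1 theta2_lt.
have qn0 : 0 <= q ^+ n by exact: exprn_ge0.
have qD : (T + 1) * q ^+ n <= D by rewrite mulrC -ler_pdivlMr.
have pE : p (1 / 2 ^+ n) = theta ^+ n by rewrite powR_gamma_dyadic// powR1 mulr1.
have h1 : theta ^+ n <= q ^+ n.
  by rewrite lerXn2r ?nnegrE// le_max lexx.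
have h2 : (2 * theta ^+ 2) ^+ n <= q ^+ n.
  by rewrite lerXn2r ?nnegrE// ?mulr_ge0 ?sqr_ge0// le_max lexx orbT.
exists (1 / 2 ^+ n); split; first by rewrite divr_gt0// exprn_gt0.
  rewrite pE; apply: le_trans h1 _; apply: le_trans qD.
  by rewrite ler_peMl// lerDr ltW.
rewrite pE; apply: le_trans qD.
have -> : (theta ^+ n) ^+ 2 * (T / (1 / 2 ^+ n) + 1) =
   T * (2 * theta ^+ 2) ^+ n + (theta ^+ n) ^+ 2.
  by rewrite exprMn (exprAC theta); field; rewrite expf_neq0.
have -> : (T + 1) * q ^+ n = T * q ^+ n + q ^+ n by ring.
apply: lerD; first by rewrite ler_wpM2l// ltW.
apply: le_trans h1; rewrite expr2 ler_piMr ?exprn_ge0// exprn_ile1//.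
by rewrite ltW// theta_lt1.
Qed.

(** Each solution comes with its own sewing exponent. [up] first brings both remainders to order 2
    gamma with a common constant; then [contraction] applies, a solution being its own Picard
    image. *)
Lemma young_unique (y1 y2 : R -> V) A M mu1 mu2 C : 0 <= A ->
  1 < mu1 -> 1 < mu2 -> N (y1 0) = 0 -> N (y2 0) = 0 ->
  (forall t, 0 <= t -> t <= T -> N (y1 t) <= M) ->
  (forall t, 0 <= t -> t <= T -> N (y2 t) <= M) ->
  (forall t s, 0 <= s -> s <= t -> t <= T -> N (dl y1 t s) <= A * p (t - s)) ->
  (forall t s, 0 <= s -> s <= t -> t <= T -> N (dl y2 t s) <= A * p (t - s)) ->
  (forall t s, 0 <= s -> s <= t -> t <= T ->
     N (young_rem y1 (Fell y1) t s) <= C * (t - s) `^ mu1) ->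
  (forall t s, 0 <= s -> s <= t -> t <= T ->
     N (young_rem y2 (Fell y2) t s) <= C * (t - s) `^ mu2) ->
  forall t, 0 <= t -> t <= T -> N (y2 t - y1 t) = 0.
Proof.
move=> A0 mu1_gt1 mu2_gt1 y10 y20 M1 M2 d1 d2 r1 r2.
have M0 : 0 <= M := le_trans (N_ge0 _) (M1 0 (lexx _) (ltW T_gt0)).
have [Hy HyE] : exists Hy, Hy = A + M by eexists.
have Hy0 : 0 <= Hy by rewrite HyE addr_ge0.
have ellH y : (forall t, 0 <= t -> t <= T -> N (y t) <= M) ->
    (forall t s, 0 <= s -> s <= t -> t <= T -> N (dl y t s) <= A * p (t - s)) ->
    forall t s, 0 <= s -> s <= t -> t <= T -> `|ell (y t) - ell (y s)| <= Hy * p (t - s).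
  by move=> yM dy t s s0 st tT; rewrite HyE; apply: (Fell_lip (tau := t - s)) => // *; exact: dy.
have [B BE] : exists B, B = csew * K * (C1 * Hy) by eexists.
have up y mu : 1 < mu -> (forall t, 0 <= t -> t <= T -> N (y t) <= M) ->
    (forall t s, 0 <= s -> s <= t -> t <= T -> N (dl y t s) <= A * p (t - s)) ->
    (forall t s, 0 <= s -> s <= t -> t <= T ->
      N (young_rem y (Fell y) t s) <= C * (t - s) `^ mu) ->
    forall t s, 0 <= s -> s <= t -> t <= T -> N (young_rem y (Fell y) t s) <= B * p (t - s) ^+ 2.
  move=> mu1' yM dy ry t s s0 st tT; rewrite BE -[_ * (C1 * Hy)]mulr1.
  apply: (@sewing_bound _ _ (fun=> 1) (t - s) mu C) => //.
  - by rewrite mulr_ge0.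
  - move=> t' s' s'0 st' tT' _; rewrite mulr1; apply: le_trans (F_lip _ _) _.
    by rewrite -mulrA ler_wpM2l// ellH.
  - by move=> t' s' s'0 st' tT' _; exact: ry.
have R1 := up _ _ mu1_gt1 M1 d1 r1; have R2 := up _ _ mu2_gt1 M2 d2 r2.
have [E EE] : exists E, E = 2 * K * C1 + csew * K * (3 * C1 + 2 * C2 * Hy).
  by eexists.
have E0 : 0 <= E.
  by rewrite EE; rewrite !(addr_ge0, mulr_ge0).
have D0 : 0 < 1 / (1 + 2 * E) by rewrite divr_gt0// ltr_wpDr// mulr_ge0.
have [tau [tau0 ptau _]] := small_window D0.
have pt0 : 0 <= p tau by exact: powR_ge0.
have ptauE : p tau * (1 + 2 * E) <= 1.
  by rewrite -ler_pdivlMr// ltr_wpDr// mulr_ge0.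
have ptau1 : p tau <= 1.
  by apply: le_trans ptauE; rewrite ler_peMr// lerDl mulr_ge0.
have small : 2 * K * C1 * p tau + csew * K * p tau * (3 * C1 + 2 * C2 * (p tau * Hy))
    <= 1 / 2.
  apply: (@le_trans _ _ (p tau * E)); last by move: ptauE pt0; lra.
  have -> : p tau * E = 2 * K * C1 * p tau + csew * K * p tau * (3 * C1 + 2 * C2 * Hy).
    by rewrite EE; ring.
  rewrite lerD2l; apply: ler_wpM2l; first by rewrite !mulr_ge0.
  by rewrite lerD2l; apply: ler_wpM2l; rewrite ?mulr_ge0// ler_piMl.
have w0 : N (y2 0 - y1 0) = 0.
  by apply/eqP; rewrite eq_le N_ge0 andbT; apply: le_trans (NB _ _) _; rewrite y10 y20 addr0.
(* Level 0 holds because the weight is at least 1 at nonnegative times; each use of [contraction]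
   then halves the bound. *)
have iter n : forall t s, 0 <= s -> s <= t -> t <= T -> t - s <= tau ->
     N (dl (fun r => y2 r - y1 r) t s) <= 2 * A * 2^-1 ^+ n * wt tau t * p (t - s).
  elim: n => [|n IH] t s s0 st tT ts.
    rewrite expr0 mulr1 dlB; apply: le_trans (NB _ _) _.
    apply: le_trans (lerD (d2 _ _ s0 st tT) (d1 _ _ s0 st tT)) _.
    rewrite -mulrDl; apply: ler_wpM2r; first exact: powR_ge0.
    apply: (@le_trans _ _ (2 * A)); first lra.
    by rewrite ler_peMr// ?mulr_ge0// wt_ge1// (le_trans s0).
  have -> : 2 * A * 2^-1 ^+ n.+1 = 2 * A * 2^-1 ^+ n / 2 by rewrite exprS; ring.
  apply: (contraction (y1 := y1) (y2 := y2) (Hy := Hy) (C := B)) => //.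
  - by rewrite !mulr_ge0// exprn_ge0// invr_ge0.
  - by move=> *; exact: ellH.
  - by move=> *; exact: R1.
  - by move=> *; exact: R2.
move=> t t0 tT; apply/eqP; rewrite eq_le N_ge0 andbT.
apply: (@le_expr_limit _ 2^-1 (4 * A * p tau * wt tau t)) => [|n].
  by rewrite invr_ge0; lra.
have An0 : 0 <= 2 * A * 2^-1 ^+ n by rewrite !mulr_ge0// exprn_ge0// invr_ge0.
apply: le_trans (N_weighted tau0 An0 w0 (iter n) t0 tT) _.
by rewrite add0r le_eqVlt; apply/orP; left; apply/eqP; ring.
Qed.

Lemma young_exists : exists y : R -> V, [/\ N (y 0) = 0,
  exists M, forall t, 0 <= t -> t <= T -> N (y t) <= M,
  exists A, forall t s, 0 <= s -> s <= t -> t <= T -> N (dl y t s) <= A * p (t - s) &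
  exists C, forall t s, 0 <= s -> s <= t -> t <= T ->
    N (young_rem y (Fell y) t s) <= C * p (t - s) ^+ 2].
Proof.
(* The budget [A] is split in two: K C0 = A / 2 bounds the increment with frozen integrand, and
   [stab] keeps the remainder below A / 2. Unlike [M], [A] does not depend on [tau]. *)
have [A AE] : exists A, A = 2 * (K * C0) by eexists.
have A0 : 0 <= A by rewrite AE !mulr_ge0.
(* [E] adds up what [small] and [stab] require: 4 C2 A comes from p(tau) (A + M) <= 2 A, and the
   last summand is for [stab]. *)
have [E EE] : exists E, E = 2 * K * C1 + csew * K * (3 * C1 + 4 * C2 * A)
    + 2 * csew * K * C1 by eexists.
have E0 : 0 <= E.
  by rewrite EE; rewrite !(addr_ge0, mulr_ge0).
have E1 : 0 < 1 + 2 * E by rewrite ltr_wpDr// mulr_ge0.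
have [tau [tau0 ptau ptau2]] := small_window (divr_gt0 ltr01 E1).
have [M ME] : exists M, M = A * p tau * (T / tau + 1) by eexists.
have pt_gt0 : 0 < p tau by exact: powR_gt0.
have pt0 := ltW pt_gt0.
have M0 : 0 <= M by rewrite ME !mulr_ge0// addr_ge0// divr_ge0// ltW.
have D1 : 1 / (1 + 2 * E) <= 1 by rewrite ler_pdivrMr// mul1r lerDl mulr_ge0.
have ptau1 : p tau <= 1 by exact: le_trans ptau D1.
have ptE : p tau * (1 + 2 * E) <= 1 by rewrite -ler_pdivlMr.
have ptME : p tau * M * (1 + 2 * E) <= A.
  have -> : p tau * M * (1 + 2 * E) = A * (p tau ^+ 2 * (T / tau + 1) * (1 + 2 * E)).
    by rewrite ME; ring.
  by rewrite ler_piMr// -ler_pdivlMr.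
have ptAE : p tau * A * (1 + 2 * E) <= A by rewrite mulrAC ler_piMl.
have ptM : p tau * M <= A.
  by apply: le_trans ptME; rewrite ler_peMr ?mulr_ge0// lerDl mulr_ge0.
have ptA : p tau * A <= A by rewrite ler_piMl.
have [Hy HyE] : exists Hy, Hy = A + M by eexists.
have Hy0 : 0 <= Hy by rewrite HyE addr_ge0.
have small : 2 * K * C1 * p tau + csew * K * p tau * (3 * C1 + 2 * C2 * (p tau * Hy))
    <= 1 / 2.
  apply: (@le_trans _ _ (p tau * E)); last by move: ptE pt0; lra.
  apply: (@le_trans _ _
    (2 * K * C1 * p tau + csew * K * p tau * (3 * C1 + 4 * C2 * A))).
    rewrite lerD2l; apply: ler_wpM2l; first by rewrite !mulr_ge0.
    rewrite lerD2l.
    have -> : 4 * C2 * A = 2 * C2 * (A + A) by ring.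
    by apply: ler_wpM2l; rewrite ?mulr_ge0// HyE mulrDr lerD.
  have : 0 <= p tau * (2 * csew * K * C1) by rewrite !mulr_ge0.
  by rewrite EE; lra.
have stab : csew * K * (C1 * Hy) * p tau <= A / 2.
  have hp : 0 <= p tau * Hy by rewrite mulr_ge0.
  have h4 : csew * K * (C1 * Hy) * p tau = csew * K * C1 * (p tau * Hy) by ring.
  rewrite h4; have : csew * K * C1 * 2 <= E.
    have h1 : 0 <= K * C1 by rewrite !mulr_ge0.
    have h2 : 0 <= csew * K * (3 * C1 + 4 * C2 * A).
      by rewrite !(mulr_ge0, addr_ge0).
    by rewrite EE; move: h1 h2; lra.
  move=> e2.
  have h5 : csew * K * C1 * 2 * (p tau * Hy) <= E * (p tau * Hy) by rewrite ler_wpM2r.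
  have h6 : E * (p tau * Hy) * 2 <= 2 * A.
    have -> : E * (p tau * Hy) * 2 =
      p tau * A * (1 + 2 * E) + p tau * M * (1 + 2 * E) - p tau * Hy by rewrite HyE; ring.
    by move: ptAE ptME hp; lra.
  by move: h5 h6; lra.
pose inv (y : R -> V) := N (y 0) = 0 /\ forall t s, 0 <= s -> s <= t -> t <= T ->
  t - s <= tau -> N (dl y t s) <= A * p (t - s).
pose next (y y' : R -> V) := N (y' 0) = 0 /\ exists C, forall t s, 0 <= s -> s <= t ->
  t <= T -> N (young_rem y' (Fell y) t s) <= C * p (t - s) ^+ 2.
have inv_sup y : inv y -> forall t, 0 <= t -> t <= T -> N (y t) <= M.
  by case=> y0 dy; rewrite ME; exact: N_unweighted.
have inv_ell y : inv y -> forall t s, 0 <= s -> s <= t -> t <= T -> t - s <= tau ->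
    `|ell (y t) - ell (y s)| <= Hy * p (t - s).
  by move=> iy; rewrite HyE; apply: Fell_lip; [case: iy|exact: inv_sup].
have inv_F y : inv y -> forall t s, 0 <= s -> s <= t -> t <= T -> t - s <= tau ->
    `|F (ell (y t)) - F (ell (y s))| <= C1 * Hy * p (t - s).
  move=> iy t s s0 st tT ts; apply: le_trans (F_lip _ _) _.
  by rewrite -mulrA ler_wpM2l// inv_ell.
have far t s : tau < t - s -> 1 <= p (t - s) / p tau.
  by move=> ts; rewrite ler_pdivlMr// mul1r powR_gamma_le// ltW.
have next_ex y : exists y', inv y -> next y y'.
  have [iy|niy] := pselect (inv y); last by exists y.
  (* [sewing_exists] wants a Hoelder bound on all of [0, T]. Within a window it is C1 Hy; beyond,
     boundedness of [F] gives 2 C0 <= 2 C0 p(t - s) / p(tau). *)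
  pose H := C1 * Hy + 2 * C0 / p tau.
  have H0 : 0 <= H by rewrite addr_ge0 ?divr_ge0 ?mulr_ge0.
  have [t s s0 st tT|Y [C [Y0 dY]]] := @sewing_exists (Fell y) H H0; last first.
    by exists Y => _; split => //; exists C.
  have pts : 0 <= p (t - s) by exact: powR_ge0.
  have [ts|ts] := leP (t - s) tau.
    apply: le_trans (inv_F _ iy _ _ s0 st tT ts) _.
    by rewrite ler_wpM2r// lerDl divr_ge0 ?mulr_ge0.
  apply: le_trans (ler_normB _ _) _.
  apply: (@le_trans _ _ (2 * C0)); first by rewrite mulr_natl mulr2n lerD.
  apply: (@le_trans _ _ (2 * C0 / p tau * p (t - s))).
    by rewrite -mulrA (mulrC (p tau)^-1) ler_peMr ?mulr_ge0// far.
  by rewrite ler_wpM2r// lerDr !mulr_ge0.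
(* The constant delivered by [next] stems from the crude global [H]. [sewing_bound] trades it for
   one in the local Hoelder constant C1 Hy, which [stab] can absorb. *)
have next_rem y y' : inv y -> next y y' -> forall t s, 0 <= s -> s <= t -> t <= T ->
    t - s <= tau -> N (young_rem y' (Fell y) t s) <= csew * K * (C1 * Hy) * p (t - s) ^+ 2.
  move=> iy [_ [C hC]] t s s0 st tT ts; rewrite -[_ * (C1 * Hy)]mulr1.
  apply: (@sewing_bound _ _ (fun=> 1) tau (2 * gamma) C) => //.
  - by move: gamma_gt; lra.
  - by rewrite mulr_ge0.
  - by move=> *; rewrite mulr1; exact: inv_F.
  - by move=> t' s' s'0 st' tT' _; rewrite -powR_sqr; exact: hC.
have next_inv y y' : inv y -> next y y' -> inv y'.
  move=> iy ny; split; first by case: ny.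
  move=> t s s0 st tT ts.
  have hr := next_rem _ _ iy ny _ _ s0 st tT ts.
  apply: le_trans (N_sub _ (dx t s (F (ell (y s))))) _.
  have pts : 0 <= p (t - s) by exact: powR_ge0.
  have hx : N (dx t s (F (ell (y s)))) <= K * p (t - s) * C0.
    by apply: le_trans (dx_le _ s0 st tT) _; rewrite ler_wpM2l// mulr_ge0.
  apply: le_trans (lerD hx hr) _.
  have e1 : csew * K * (C1 * Hy) * p (t - s) ^+ 2 <=
      csew * K * (C1 * Hy) * p tau * p (t - s).
    rewrite expr2 mulrA ler_wpM2r// ler_wpM2l ?powR_gamma_le ?subr_ge0//.
    by rewrite !mulr_ge0.
  have e2 : csew * K * (C1 * Hy) * p tau * p (t - s) <= A / 2 * p (t - s).
    by rewrite ler_wpM2r.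
  by move: e1 e2; rewrite AE; lra.
have [nx hnx] := choice next_ex.
pose y_ k := iter k nx (fun=> 0).
have inv_y k : inv (y_ k).
  elim: k => [|k IH]; last by apply: (next_inv (y_ k)) => //; exact: hnx.
  split=> // t s s0 st tT ts.
  by rewrite /dl S_0 subrr N0 mulr_ge0// powR_ge0.
have next_y k : next (y_ k) (y_ k.+1) by exact: hnx.
have diff k : forall t s, 0 <= s -> s <= t -> t <= T -> t - s <= tau ->
    N (dl (fun r => y_ k.+1 r - y_ k r) t s) <= 2 * A * 2^-1 ^+ k * wt tau t * p (t - s).
  elim: k => [|k IH] t s s0 st tT ts.
    rewrite expr0 mulr1 dlB; apply: le_trans (NB _ _) _.
    have [[_ d1] [_ d0]] := (inv_y 1%N, inv_y 0%N).
    apply: le_trans (lerD (d1 _ _ s0 st tT ts) (d0 _ _ s0 st tT ts)) _.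
    rewrite -mulrDl; apply: ler_wpM2r; first exact: powR_ge0.
    apply: (@le_trans _ _ (2 * A)); first lra.
    by rewrite ler_peMr// ?mulr_ge0// wt_ge1// (le_trans s0).
  have -> : 2 * A * 2^-1 ^+ k.+1 = 2 * A * 2^-1 ^+ k / 2 by rewrite exprS; ring.
  apply: (contraction (y1 := y_ k) (y2 := y_ k.+1) (Hy := Hy)
           (C := csew * K * (C1 * Hy))) => //.
  - by rewrite !mulr_ge0// exprn_ge0// invr_ge0.
  - have [[z1 _] [z0 _]] := (inv_y k.+1, inv_y k).
    apply/eqP; rewrite eq_le N_ge0 andbT; apply: le_trans (NB _ _) _.
    by rewrite z1 z0 addr0.
  - exact: inv_ell.
  - exact: next_rem.
  - exact: next_rem.
have half01 : 0 <= (2^-1 : R) < 1 by rewrite invr_ge0; lra.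
have diffN k t : 0 <= t -> t <= T ->
    N (y_ k.+1 t - y_ k t) <= 4 * A * p tau * wt tau t * 2^-1 ^+ k.
  move=> t0 tT.
  have Ak : 0 <= 2 * A * 2^-1 ^+ k by rewrite !mulr_ge0// exprn_ge0// invr_ge0.
  have w0 : N (y_ k.+1 0 - y_ k 0) = 0.
    have [[z1 _] [z0 _]] := (inv_y k.+1, inv_y k).
    apply/eqP; rewrite eq_le N_ge0 andbT; apply: le_trans (NB _ _) _.
    by rewrite z1 z0 addr0.
  apply: le_trans (N_weighted tau0 Ak w0 (diff k) t0 tT) _.
  by rewrite le_eqVlt; apply/orP; left; apply/eqP; ring.
have /choice[y hy] : forall t, exists v, 0 <= t -> t <= T -> forall k,
    N (y_ k t - v) <= 4 * A * p tau * wt tau t / (1 - 2^-1) * 2^-1 ^+ k.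
  move=> t; have [/andP[t0 tT]|tn] := boolP (0 <= t <= T); last first.
    by exists 0 => t0 tT; rewrite t0 tT in tn.
  by have [v hv] := N_complete half01 (fun k => diffN k t t0 tT); exists v.
pose L t := 4 * A * p tau * wt tau t / (1 - 2^-1).
have hL k t : 0 <= t -> t <= T -> N (y t - y_ k t) <= L t * 2^-1 ^+ k.
  by move=> t0 tT; rewrite -NN opprB; exact: hy.
have y0 : N (y 0) = 0.
  apply/eqP; rewrite eq_le N_ge0 andbT.
  apply: (@le_expr_limit _ 2^-1 (L 0)) => // k; rewrite add0r.
  apply: le_trans (N_sub _ (y_ k 0)) _; have [z0 _] := inv_y k.
  by rewrite z0 add0r; apply: hL => //; exact: ltW.
have iy : inv y.
  split=> // t s s0 st tT ts.
  have [t0 sT] := (le_trans s0 st, le_trans st tT).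
  apply: (@le_expr_limit _ 2^-1 (L t + L s)) => // k.
  apply: le_trans (N_sub _ (dl (y_ k) t s)) _; have [_ dk] := inv_y k.
  apply: lerD; first exact: dk.
  rewrite -dlB; apply: le_trans (dl_le _ st) _.
  by rewrite mulrDl; apply: lerD; exact: hL.
(* The comparison is with the remainder of [y_ k.+1] for the integrand of [y_ k]; the errors of path
   and integrand are both geometric in [k]. *)
have ry t s : 0 <= s -> s <= t -> t <= T -> t - s <= tau ->
    N (young_rem y (Fell y) t s) <= csew * K * (C1 * Hy) * p (t - s) ^+ 2.
  move=> s0 st tT ts; have [t0 sT] := (le_trans s0 st, le_trans st tT).
  have pts : 0 <= p (t - s) by exact: powR_ge0.
  apply: (@le_expr_limit _ 2^-1 (L t + L s + K * p (t - s) * (C1 * L s))) => // k.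
  apply: le_trans (N_sub _ (young_rem (y_ k.+1) (Fell (y_ k)) t s)) _.
  apply: lerD; first exact: (next_rem (y_ k)).
  rewrite -young_remB; apply: le_trans (NB _ _) _; rewrite mulrDl; apply: lerD.
    apply: le_trans (dl_le _ st) _.
    have k0 : 0 <= 2^-1 ^+ k :> R by rewrite exprn_ge0// invr_ge0.
    have Lh r : 0 <= r -> r <= T -> N (y r - y_ k.+1 r) <= L r * 2^-1 ^+ k.
      move=> r0 rT; apply: le_trans (hL _ _ r0 rT) _; rewrite ler_wpM2l//.
        by have := le_trans (N_ge0 _) (hL 0%N _ r0 rT); rewrite expr0 mulr1.
      by rewrite exprS ler_piMl//; case/andP: half01 => _ /ltW.
    by rewrite mulrDl; apply: lerD; exact: Lh.
  apply: le_trans (dx_le _ s0 st tT) _.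
  rewrite -(mulrA (K * p (t - s))); apply: ler_wpM2l; first by rewrite mulr_ge0.
  apply: le_trans (F_lip _ _) _; rewrite -mulrA ler_wpM2l// -ellB.
  by apply: le_trans (ell_le _) _; exact: hL.
have yM := inv_sup _ iy.
exists y; split => //.
- by exists M.
- exists (A + 2 * M / p tau) => t s s0 st tT.
  have [t0 sT] := (le_trans s0 st, le_trans st tT).
  have pts : 0 <= p (t - s) by exact: powR_ge0.
  have [ts|ts] := leP (t - s) tau.
    have [_ dy] := iy; apply: le_trans (dy _ _ s0 st tT ts) _.
    by rewrite ler_wpM2r// lerDl !mulr_ge0// invr_ge0.
  apply: le_trans (dl_le _ st) _.
  apply: (@le_trans _ _ (2 * M * (p (t - s) / p tau))).
    apply: (@le_trans _ _ (2 * M)); last by rewrite ler_peMr ?mulr_ge0// far.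
    by rewrite mulr_natl mulr2n lerD// yM.
  have : 0 <= A * p (t - s) by rewrite mulr_ge0.
  have -> : 2 * M * (p (t - s) / p tau) = 2 * M / p tau * p (t - s) by ring.
  by rewrite (mulrDl A) lerDr.
(* Beyond the window the remainder is merely bounded, by 2 M + K p(T) C0; since p(t - s) / p(tau) >=
   1 there, dividing by p(tau)^2 restores the order 2 gamma. *)
- exists (csew * K * (C1 * Hy) + (2 * M + K * p T * C0) / p tau ^+ 2) => t s s0 st tT.
  have [t0 sT] := (le_trans s0 st, le_trans st tT).
  have pts : 0 <= p (t - s) by exact: powR_ge0.
  have B0 : 0 <= 2 * M + K * p T * C0 by rewrite addr_ge0 ?mulr_ge0 ?powR_ge0.
  rewrite (mulrDl (csew * _ * _)); have [ts|ts] := leP (t - s) tau.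
    apply: le_trans (ry _ _ s0 st tT ts) _; rewrite lerDl.
    by rewrite !mulr_ge0// invr_ge0 exprn_ge0.
  rewrite -[leLHS]add0r; apply: lerD; first by rewrite !mulr_ge0.
  apply: (@le_trans _ _ (2 * M + K * p T * C0)).
    apply: le_trans (NB _ _) _; apply: lerD.
      apply: le_trans (dl_le _ st) _.
      by rewrite mulr_natl mulr2n lerD// yM.
    apply: le_trans (dx_le _ s0 st tT) _; apply: ler_pM => //.
      by rewrite mulr_ge0.
    by rewrite ler_wpM2l// powR_gamma_le// ?subr_ge0//; lra.
  move: (2 * M + K * p T * C0) B0 => B B0; rewrite -mulrA ler_peMr//.
  have -> : p tau ^- 2 * p (t - s) ^+ 2 = (p (t - s) / p tau) ^+ 2.
    by rewrite exprMn exprVn mulrC.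
  by rewrite exprn_ege1// far.
Qed.

End Picard.

End ConvolutionalYoung.

(** * Matrix norms and mean value inequalities *)

Section MatrixNorm.
Variable R : realType.

Lemma mx_norm_entry p q (A : 'M[R]_(p, q)) i j : `|A i j| <= `|A|.
Proof.
rewrite [leRHS]mx_normrE.
exact: (le_bigmax _ (fun ij : 'I_p * 'I_q => `|A ij.1 ij.2|) (i, j)).
Qed.

Lemma mx_norm_le p q (A : 'M[R]_(p, q)) c : 0 <= c ->
  (forall i j, `|A i j| <= c) -> `|A| <= c.
Proof.
move=> c0 h; rewrite [leLHS]mx_normrE.
by apply/bigmax_leP; split => // ij _; exact: h.
Qed.

Lemma mulmx_norm_le p q r (A : 'M[R]_(p, q)) (B : 'M[R]_(q, r)) :
  `|A *m B| <= q%:R * `|A| * `|B|.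
Proof.
apply: mx_norm_le => [|i j]; first by rewrite !mulr_ge0.
rewrite mxE; apply: le_trans (ler_norm_sum _ _ _) _.
apply: (@le_trans _ _ (\sum_(k < q) `|A| * `|B|)).
  by apply: ler_sum => k _; rewrite normrM ler_pM// mx_norm_entry.
by rewrite sumr_const card_ord -mulrA mulr_natl.
Qed.

(** The scalar mean value theorem is applied to each entry along the segment from [b] to [a]; since
    the norm is the largest absolute entry, no dimensional constant is lost. *)
Lemma mx_mean_value m p q (f : 'rV[R]_m -> 'M[R]_(p, q)) (C : R) : 0 <= C ->
  (forall a, differentiable f a) -> (forall a v, `|'d f a v| <= C * `|v|) ->
  forall a b, `|f a - f b| <= C * `|a - b|.
Proof.
move=> C0 df dC a b; apply: mx_norm_le => [|i j]; first by rewrite mulr_ge0.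
pose l (t : R) := b + t *: (a - b).
pose g (t : R) : R := f (l t) i j.
have il t : is_diff t l (cst 0 + *:%R ^~ (a - b)).
  exact: (is_diffD (is_diff_cst b t) (is_diff_scalel t (a - b))).
have dl' t : differentiable l t by exact: ex_diff.
have dg (t : R) : is_derive t 1 g ('d f (l t) (a - b) i j).
  have dfl : differentiable (f \o l) t by exact: differentiable_comp.
  have dg : differentiable g t.
    exact: (differentiable_comp dfl (differentiable_coord _ i j)).
  apply: DeriveDef; first exact: diff_derivable.
  have -> : 'd f (l t) (a - b) = 'D_1 (f \o l) t.
    have ifl := is_diff_comp (il t) (differentiableP (df (l t))).
    by rewrite deriveE// (@diff_val _ _ _ _ _ _ _ ifl) /= fctE add0r scale1r.
  by rewrite derive_mx ?mxE//; exact: diff_derivable.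
have [c _ gE] := @MVT_segment R g (fun t => 'd f (l t) (a - b) i j) 0 1 ler01
  (fun t _ => dg t) (derivable_within_continuous (fun t _ => @ex_derive _ _ _ _ _ _ _ (dg t))).
have : g 1 - g 0 = f a i j - f b i j.
  by rewrite /g /l scale1r scale0r addr0 (addrC b) subrK.
rewrite gE subr0 mulr1 !mxE => <-.
by apply: le_trans (mx_norm_entry _ _ _) _; exact: dC.
Qed.

(** The second difference is the increment from [b] to [a] of the map sending x to sigma (x + v) -
    sigma x. Its differential is a difference of ['d sigma] at points [v] apart, so the mean value
    inequality is used twice. *)
Lemma C2b_bounds d m (sigma : 'rV[R]_m -> 'M[R]_(d, m)) : C2b sigma ->
  exists C0 C1 C2 : R, [/\ 0 <= C0, 0 <= C1, 0 <= C2 &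
  [/\ forall a, `|sigma a| <= C0, forall a b, `|sigma a - sigma b| <= C1 * `|a - b| &
   forall a b v, `|sigma (a + v) - sigma a - (sigma (b + v) - sigma b)|
      <= C2 * `|v| * `|a - b|]].
Proof.
move=> [[C0 h0] [ds [dds [_ [[C1 h1] [C2 h2]]]]]].
have nneg (C x : R) : 0 <= x -> C * x <= `|C| * x.
  by move=> x0; rewrite ler_wpM2r// ler_norm.
exists `|C0|, `|C1|, `|C2|; split => //; split.
- by move=> a; apply: le_trans (h0 a) (ler_norm _).
- apply: mx_mean_value => // a v; apply: le_trans (h1 a v) _.
  exact: nneg.
- move=> a b v.
  have dshift x : is_diff x (fun y : 'rV[R]_m => y + v) idfun.
    have := is_diffD (is_diff_id x) (is_diff_cst v x).
    by rewrite (_ : id + cst 0 = idfun)//; apply/funext => y; rewrite fctE addr0.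
  pose sh (y : 'rV[R]_m) := y + v.
  have iG x := is_diffB (is_diff_comp (dshift x) (differentiableP (ds (sh x))))
    (differentiableP (ds x)).
  have dG x := @ex_diff _ _ _ _ _ _ _ (iG x).
  apply: (@mx_mean_value _ _ _ (sigma \o sh - sigma) (`|C2| * `|v|)) => // x w.
  rewrite (@diff_val _ _ _ _ _ _ _ (iG x)).
  rewrite fctE /=.
  have h : `|'d sigma (x + v) w - 'd sigma x w| <= `|C2| * `|w| * `|x + v - x|.
    apply: (@mx_mean_value _ _ _ (fun y => 'd sigma y w)) => // y u.
    apply: le_trans (h2 y w u) _; rewrite -!mulrA.
    by apply: nneg; rewrite mulr_ge0.
  rewrite -[X in `|X|]/('d sigma (x + v) w - 'd sigma x w).
  apply: le_trans h _.
  by rewrite (addrC x) addrK mulrAC.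
Qed.

End MatrixNorm.

(** * The weighted space L_gamma: completeness, exponential decay, integration against phi *)

Section WeightedL1.
Variables (R : realType) (phi : R -> R) (gamma : R).
Local Notation D := (`]0%R, +oo[%classic : set R).
Local Notation mu := (@lebesgue_measure R).
Hypothesis mphi : measurable_fun D phi.

Let mD : measurable (D : set (measurableTypeR R)). Proof. exact: measurable_itv. Qed.

Let Dgt0 (xi : R) : D xi -> 0 < xi. Proof. by rewrite /= in_itv/= andbT. Qed.

Definition mxmeas p q (g : R -> 'M[R]_(p, q)) :=
  forall i j, measurable_fun D (fun xi => g xi i j).

Lemma measurable_mx_norm p q (g : R -> 'M[R]_(p, q)) : mxmeas g ->
  measurable_fun D (fun xi => `|g xi|).
Proof.
move=> mg.
rewrite (_ : (fun _ => _) = fun xi => \big[Num.max/0]_ij `|g xi ij.1 ij.2|); last first.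
  by apply/funext => xi; rewrite [LHS]mx_normrE.
elim: (index_enum _) => [|ij s IH].
  by rewrite (_ : (fun _ => _) = cst 0)//; apply/funext => xi; rewrite big_nil.
rewrite (_ : (fun _ => _) = fun xi => Num.max `|g xi ij.1 ij.2|
  (\big[Num.max/0]_(k <- s) `|g xi k.1 k.2|)).
  by apply: measurable_maxr => //; exact/measurableT_comp.
by apply/funext => xi; rewrite big_cons.
Qed.

Definition wgt (xi : R) : R := `|phi xi| * (1 + xi `^ gamma).

Lemma wgt_ge0 xi : 0 <= wgt xi.
Proof. by rewrite mulr_ge0// addr_ge0// powR_ge0. Qed.

Lemma measurable_wgt : measurable_fun D wgt.
Proof.
apply: measurable_funM; first exact: measurableT_comp.
apply: measurable_funD => //; apply: measurable_funTS; exact: measurable_powR.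
Qed.

Lemma measurable_integrand p q (g : R -> 'M[R]_(p, q)) : mxmeas g ->
  measurable_fun D (fun xi => (wgt xi * `|g xi|)%:E).
Proof.
move=> mg; apply/measurable_EFinP/measurable_funM; first exact: measurable_wgt.
exact: measurable_mx_norm.
Qed.

Lemma integrand_ge0 p q (g : R -> 'M[R]_(p, q)) xi : (0 <= (wgt xi * `|g xi|)%:E)%E.
Proof. by rewrite lee_fin mulr_ge0// wgt_ge0. Qed.

Lemma NL_ge0 p q (g : R -> 'M[R]_(p, q)) : (0 <= NL phi gamma g)%E.
Proof. by apply: integral_ge0 => xi _; exact: integrand_ge0. Qed.

Lemma eq_NL p q (g h : R -> 'M[R]_(p, q)) : (forall xi, 0 < xi -> g xi = h xi) ->
  NL phi gamma g = NL phi gamma h.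
Proof.
move=> gh; apply: eq_integral => xi; rewrite inE => /Dgt0 xi0.
by rewrite gh.
Qed.

Lemma NL_le p q p' q' (g : R -> 'M[R]_(p, q)) (h : R -> 'M[R]_(p', q')) (c : R) :
  mxmeas g -> mxmeas h -> 0 <= c -> (forall xi, 0 < xi -> `|g xi| <= c * `|h xi|) ->
  (NL phi gamma g <= c%:E * NL phi gamma h)%E.
Proof.
move=> mg mh c0 gh; rewrite /NL -ge0_integralZl_EFin//; last 2 first.
- by move=> xi _; exact: integrand_ge0.
- exact: measurable_integrand.
apply: ge0_le_integral => //.
- by move=> xi _; exact: integrand_ge0.
- exact: measurable_integrand.
- by apply: measurable_funeM; exact: measurable_integrand.
- move=> xi /Dgt0 xi0; rewrite -EFinM lee_fin mulrCA.
  by rewrite -/(wgt xi) ler_wpM2l ?wgt_ge0// gh.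
Qed.

Lemma mxmeasD p q (g h : R -> 'M[R]_(p, q)) : mxmeas g -> mxmeas h ->
  mxmeas (fun xi => g xi + h xi).
Proof.
move=> mg mh i j.
apply: (eq_measurable_fun (fun xi => g xi i j + h xi i j)) => [xi _|].
  by rewrite mxE.
exact: measurable_funD.
Qed.

Lemma mxmeasN p q (g : R -> 'M[R]_(p, q)) : mxmeas g -> mxmeas (fun xi => - g xi).
Proof.
move=> mg i j.
apply: (eq_measurable_fun (fun xi => - g xi i j)) => [xi _|]; first by rewrite mxE.
exact: measurableT_comp.
Qed.

Lemma mxmeasB p q (g h : R -> 'M[R]_(p, q)) : mxmeas g -> mxmeas h ->
  mxmeas (fun xi => g xi - h xi).
Proof. by move=> mg mh; apply: mxmeasD => //; exact: mxmeasN. Qed.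

Lemma mxmeas_cst p q (M : 'M[R]_(p, q)) : mxmeas (fun=> M).
Proof. by move=> i j; exact: measurable_cst. Qed.

Lemma mxmeas_decay p q (g : R -> 'M[R]_(p, q)) t : mxmeas g ->
  mxmeas (fun xi => expR (- (xi * t)) *: g xi).
Proof.
move=> mg i j.
apply: (eq_measurable_fun (fun xi : R => expR (- (xi * t)) * g xi i j)) => [xi _|].
  by rewrite mxE.
apply: measurable_funM => //.
apply: measurableT_comp => //; apply: measurableT_comp => //.
exact: measurable_funM.
Qed.

Lemma mxmeas_mul p q r (g : R -> 'M[R]_(p, q)) (M : 'M[R]_(q, r)) : mxmeas g ->
  mxmeas (fun xi => g xi *m M).
Proof.
move=> mg i j.
apply: (eq_measurable_fun (fun xi => \sum_k g xi i k * M k j)) => [xi _|].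
  by rewrite mxE.
by apply: measurable_sum => k; apply: measurable_funM.
Qed.

Lemma NLD p q (g h : R -> 'M[R]_(p, q)) : mxmeas g -> mxmeas h ->
  (NL phi gamma (fun xi => (g xi + h xi)%R) <= NL phi gamma g + NL phi gamma h)%E.
Proof.
move=> mg mh; rewrite /NL -ge0_integralD//; last 4 first.
- by move=> xi _; exact: integrand_ge0.
- exact: measurable_integrand.
- by move=> xi _; exact: integrand_ge0.
- exact: measurable_integrand.
apply: ge0_le_integral => //.
- by move=> xi _; exact: (integrand_ge0 (fun xi => g xi + h xi)).
- exact: (measurable_integrand (mxmeasD mg mh)).
- by apply: emeasurable_funD; exact: measurable_integrand.
- move=> xi _; rewrite -EFinD lee_fin -mulrDr -/(wgt xi) ler_wpM2l ?wgt_ge0//.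
  exact: ler_normD.
Qed.

Lemma NLN p q (g : R -> 'M[R]_(p, q)) : NL phi gamma (fun xi => - g xi) = NL phi gamma g.
Proof. by apply: eq_integral => xi _; rewrite normrN. Qed.

Lemma NL0 p q : NL phi gamma (fun=> 0 : 'M[R]_(p, q)) = 0%E.
Proof.
rewrite /NL (eq_integral (cst 0%E)) ?integral0// => xi _.
by rewrite normr0 mulr0.
Qed.

Lemma NLB p q (g h : R -> 'M[R]_(p, q)) : mxmeas g -> mxmeas h ->
  (NL phi gamma (fun xi => (g xi - h xi)%R) <= NL phi gamma g + NL phi gamma h)%E.
Proof.
by move=> mg mh; rewrite -(NLN h); apply: NLD => //; exact: mxmeasN.
Qed.

Local Notation inL := (in_Lg phi gamma).

Lemma in_Lg_le p q p' q' (g : R -> 'M[R]_(p, q)) (h : R -> 'M[R]_(p', q')) (c : R) :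
  mxmeas g -> inL h -> 0 <= c -> (forall xi, 0 < xi -> `|g xi| <= c * `|h xi|) -> inL g.
Proof.
move=> mg [mh hfin] c0 gh; split => //.
by apply: le_lt_trans (NL_le mg mh c0 gh) _; rewrite lte_mul_pinfty// lee_fin.
Qed.

Lemma in_Lg0 p q : inL (fun=> 0 : 'M[R]_(p, q)).
Proof. by split; [exact: mxmeas_cst|rewrite NL0 ltry]. Qed.

Lemma in_LgD p q (g h : R -> 'M[R]_(p, q)) : inL g -> inL h ->
  inL (fun xi => g xi + h xi).
Proof.
move=> [mg gfin] [mh hfin]; split; first exact: mxmeasD.
by apply: le_lt_trans (NLD mg mh) _; exact: lte_add_pinfty.
Qed.

Lemma in_LgN p q (g : R -> 'M[R]_(p, q)) : inL g -> inL (fun xi => - g xi).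
Proof. by move=> [mg gfin]; split; [exact: mxmeasN|rewrite NLN]. Qed.

Lemma in_LgB p q (g h : R -> 'M[R]_(p, q)) : inL g -> inL h ->
  inL (fun xi => g xi - h xi).
Proof. by move=> Lg Lh; apply: in_LgD => //; exact: in_LgN. Qed.

Lemma decay_le p q (M : 'M[R]_(p, q)) t xi : 0 <= t -> 0 < xi ->
  `|expR (- (xi * t)) *: M| <= 1 * `|M|.
Proof.
move=> t0 xi0; rewrite normrZ; apply: ler_wpM2r => //.
by rewrite ger0_norm ?expR_ge0// expR_le1 oppr_le0 mulr_ge0// ltW.
Qed.

Lemma in_Lg_decay p q (g : R -> 'M[R]_(p, q)) t : 0 <= t -> inL g ->
  inL (fun xi => expR (- (xi * t)) *: g xi).
Proof.
move=> t0 Lg; have [mg _] := Lg; apply: (in_Lg_le _ Lg ler01).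
- exact: mxmeas_decay.
- by move=> xi xi0; exact: decay_le.
Qed.

Lemma in_Lg_mul p q r (g : R -> 'M[R]_(p, q)) (M : 'M[R]_(q, r)) : inL g ->
  inL (fun xi => g xi *m M).
Proof.
move=> Lg; have [mg _] := Lg.
apply: (@in_Lg_le _ _ _ _ _ _ (q%:R * `|M|) _ Lg); first exact: mxmeas_mul.
- by rewrite mulr_ge0.
- by move=> xi _; rewrite mulrAC; exact: mulmx_norm_le.
Qed.

Lemma NL_mul p q r (g : R -> 'M[R]_(p, q)) (M : 'M[R]_(q, r)) : mxmeas g ->
  (NL phi gamma (fun xi => g xi *m M) <= (q%:R * `|M|)%:E * NL phi gamma g)%E.
Proof.
move=> mg; apply: NL_le => //; first exact: mxmeas_mul.
by move=> xi _; rewrite mulrAC; exact: mulmx_norm_le.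
Qed.

Lemma NL_fin p q (g : R -> 'M[R]_(p, q)) : inL g -> NL phi gamma g \is a fin_num.
Proof. by move=> [_ gfin]; rewrite ge0_fin_numE// NL_ge0. Qed.

(** An upper limit exists for every sequence, so it can define a candidate limit at every point. The
    two-sided bound excludes the infinite values that [fine] would hide. *)
Lemma limn_esup_bounds (u : nat -> R) (n : nat) (a b : R) :
  (forall k, (n <= k)%N -> a <= u k <= b) ->
  a <= fine (limn_esup (fun k => (u k)%:E)) <= b.
Proof.
move=> h; pose l := limn_esup (fun k => (u k)%:E).
have lb : (l <= b%:E)%E.
  rewrite /l limn_esup_lim; apply: lime_le; first exact: is_cvg_esups.
  exists n => // k /= nk; apply: ge_ereal_sup => _ [i /= ki <-].
  by rewrite lee_fin; case/andP: (h i (leq_trans nk ki)).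
have la : (a%:E <= l)%E.
  rewrite /l limn_esup_lim; apply: lime_ge; first exact: is_cvg_esups.
  exists n => // k /= nk; apply: (@le_trans _ _ (u k)%:E).
    by rewrite lee_fin; case/andP: (h k nk).
  by apply: ereal_sup_ubound; exists k => /=.
rewrite -/l; case: l la lb => [r| |]; rewrite ?lee_fin ?leye_eq ?leeNy_eq//.
by move=> -> ->.
Qed.

Lemma telescope_norm p q (v : nat -> 'M[R]_(p, q)) n k :
  `|v (n + k)%N - v n| <= \sum_(i < k) `|v (n + i).+1 - v (n + i)%N|.
Proof.
elim: k => [|k IH]; first by rewrite addn0 subrr normr0 big_ord0.
rewrite big_ord_recr /= addnS; apply: le_trans _ (lerD IH (lexx _)).
by rewrite [leRHS]addrC; apply: le_trans (ler_normD _ _); rewrite subrKA.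
Qed.

(** Riesz-Fischer with a rate: the distance to the limit is dominated pointwise by the series of
    later increments, and integrating this nonnegative series term by term leaves a geometric
    sum. *)
Lemma Lg_complete m (v : nat -> R -> 'rV[R]_m) (C q : R) : 0 <= q < 1 ->
  (forall n, inL (v n)) ->
  (forall n, (NL phi gamma (fun xi => (v n.+1 xi - v n xi)%R) <= (C * q ^+ n)%:E)%E) ->
  exists2 v' : R -> 'rV[R]_m, inL v' & forall n,
    (NL phi gamma (fun xi => (v n xi - v' xi)%R) <= (C / (1 - q) * q ^+ n)%:E)%E.
Proof.
move=> /andP[q0 q1] Lv vC.
have mv n : mxmeas (v n) by case: (Lv n).
pose f k xi := (wgt xi * `|v k.+1 xi - v k xi|)%:E.
have f0 k xi : (0 <= f k xi)%E.
  exact: (integrand_ge0 (fun xi => v k.+1 xi - v k xi)).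
have mf k : measurable_fun D (f k).
  by apply: measurable_integrand; exact: mxmeasB.
(* An entrywise upper limit is measurable without discarding a null set. Where the sequence
   diverges, either the weight vanishes or the series of weighted increments is infinite, and the
   value chosen is harmless. *)
pose v' xi : 'rV[R]_m := \row_j fine (limn_esup (fun k => (v k xi 0 j)%:E)).
have mv' : mxmeas v'.
  move=> i j.
  apply: (eq_measurable_fun (fun xi => fine (limn_esup (fun k => (v k xi 0 j)%:E)))).
    by move=> xi _; rewrite mxE.
  apply: (measurableT_comp (f := fine)) => //.
  by apply: measurable_fun_limn_esup => k; apply/measurable_EFinP; exact: mv.
have C0 : 0 <= C.
  have := le_trans (NL_ge0 _) (vC 0%N).
  by rewrite expr0 mulr1 lee_fin.
(* Where the series diverges its sum is +oo, so the inequality holds at every xi. *)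
have key n xi : ((wgt xi * `|v n xi - v' xi|)%:E <= \sum_(k <oo) f (n + k)%N xi)%E.
  set tl := (\sum_(k <oo) _)%E.
  have tl0 : (0 <= tl)%E by apply: nneseries_ge0 => k _ _; exact: f0.
  have [w0|wn0] := eqVneq (wgt xi) 0; first by rewrite w0 mul0r.
  have wgt0 : 0 < wgt xi by rewrite lt_neqAle eq_sym wn0 wgt_ge0.
  case tlE : tl tl0 => [r| |] // r0; last by rewrite leey.
  rewrite lee_fin in r0; rewrite lee_fin -ler_pdivlMl// mulrC.
  apply: mx_norm_le => [|i j]; first by rewrite divr_ge0// ltW.
  rewrite !mxE (ord1 i) distrC.
  have near k : (n <= k)%N -> v n xi 0 j - r / wgt xi <= v k xi 0 j <= v n xi 0 j + r / wgt xi.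
    move=> nk; rewrite -ler_distl.
    have -> : v k xi 0 j - v n xi 0 j = (v k xi - v n xi) 0 j by rewrite !mxE.
    apply: le_trans (mx_norm_entry _ _ _) _.
    rewrite -(subnKC nk); apply: le_trans (telescope_norm (fun k => v k xi) n _) _.
    rewrite ler_pdivlMr// mulrC mulr_sumr -lee_fin -tlE.
    rewrite -sumEFin; apply: le_trans (nneseries_lim_ge (k - n)%N _); last first.
      by move=> i' _ _; exact: f0.
    by rewrite big_mkord.
  by rewrite ler_distl; exact: limn_esup_bounds near.
have bound n : (NL phi gamma (fun xi => (v n xi - v' xi)%R) <= (C / (1 - q) * q ^+ n)%:E)%E.
  apply: (@le_trans _ _ (\int[mu]_(xi in D) (\sum_(k <oo) f (n + k)%N xi))%E).
    apply: ge0_le_integral => //.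
    - by move=> xi _; exact: (integrand_ge0 (fun xi => v n xi - v' xi)).
    - by apply: measurable_integrand; exact: mxmeasB.
    - exact: (@ge0_emeasurable_sum _ _ _ D (fun k => f (n + k)%N) xpredT
        (fun k xi _ _ => f0 (n + k)%N xi) (fun k _ => mf (n + k)%N)).
    - by move=> xi _; exact: key.
  rewrite integral_nneseries//; last by move=> k; exact: mf.
  apply: lime_le.
    apply: is_cvg_nneseries => k _ _.
    exact: (NL_ge0 (fun xi => v (n + k).+1 xi - v (n + k)%N xi)).
  exists 0%N => // j _ /=.
  apply: (@le_trans _ _ (\sum_(0 <= k < j) (C * q ^+ (n + k))%:E)%E).
    by apply: lee_sum => k _; exact: vC.
  rewrite sumEFin lee_fin big_mkord.
  have -> : \sum_(k < j) C * q ^+ (n + k) = C * q ^+ n * ((1 - q ^+ j) / (1 - q)).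
    elim: j => [|j IH]; first by rewrite big_ord0 expr0 subrr mul0r mulr0.
    rewrite big_ord_recr /= IH exprD [q ^+ j.+1]exprS; field.
    by rewrite subr_eq0 gt_eqF.
  rewrite [leRHS]mulrAC -mulrA -[leRHS]mulrA; apply: ler_wpM2l => //.
  apply: ler_wpM2l; first exact: exprn_ge0.
  rewrite ler_pdivrMr ?subr_gt0// mulVf ?subr_eq0 ?gt_eqF//.
  by rewrite gerBl exprn_ge0.
exists v' => //.
have Ld : inL (fun xi => v 0%N xi - v' xi).
  split; first exact: mxmeasB.
  by apply: le_lt_trans (bound 0%N) _; rewrite ltry.
have -> : v' = fun xi => v 0%N xi - (v 0%N xi - v' xi).
  by apply/funext => xi; rewrite opprB addrC subrK.
exact: in_LgB.
Qed.

Lemma integrable_integrand p q (g : R -> 'M[R]_(p, q)) : inL g ->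
  mu.-integrable D (fun xi => (wgt xi * `|g xi|)%:E).
Proof.
move=> [mg gfin]; apply/integrableP; split; first exact: measurable_integrand.
apply: le_lt_trans gfin; rewrite le_eqVlt; apply/orP; left; apply/eqP.
by apply: eq_integral => xi _; rewrite gee0_abs ?integrand_ge0.
Qed.

Lemma integrable_phi m (g : R -> 'rV[R]_m) j : inL g ->
  mu.-integrable D (EFin \o (fun eta => phi eta * g eta 0 j)).
Proof.
move=> Lg; have [mg _] := Lg; have ig := integrable_integrand Lg.
apply: (le_integrable mD _ _ ig) => [|xi /Dgt0 xi0 /=].
  by apply/measurable_EFinP; apply: measurable_funM => //; exact: mg.
rewrite lee_fin (ger0_norm (mulr_ge0 (wgt_ge0 xi) (normr_ge0 _))) normrM.
apply: ler_pM => //; last exact: mx_norm_entry.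
by rewrite /wgt ler_peMr// lerDl powR_ge0.
Qed.

(** Two cases are served: [g] equal to [h], and [g] equal to h - S_t h, whose pointwise factor 1 -
    e^(-xi t) is absorbed by the weight of [h]. *)
Lemma phi_int_le m (g h : R -> 'rV[R]_m) (c : R) : inL g -> inL h -> 0 <= c ->
  (forall xi, 0 < xi -> `|phi xi| * `|g xi| <= c * (wgt xi * `|h xi|)) ->
  `|phi_int phi g| <= c * fine (NL phi gamma h).
Proof.
move=> Lg Lh c0 gh; have [mg _] := Lg; have [mh _] := Lh.
have N0 : 0 <= fine (NL phi gamma h) by rewrite fine_ge0// NL_ge0.
apply: mx_norm_le => [|i j]; first by rewrite mulr_ge0.
rewrite mxE; have ig := integrable_phi j Lg.
apply: le_trans (le_normr_Rintegral mD ig) _.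
rewrite -lee_fin EFinM (fineK (NL_fin Lh)) /Rintegral fineK; last first.
  have [_] := integrableP _ _ _ ig => fin; rewrite ge0_fin_numE//.
  by apply: integral_ge0.
rewrite /NL -ge0_integralZl_EFin//; last 2 first.
- by move=> xi _; exact: integrand_ge0.
- exact: measurable_integrand.
have mpg : measurable_fun D (fun eta => phi eta * g eta 0 j).
  by apply: measurable_funM => //; exact: mg.
apply: ge0_le_integral => //.
- by apply/measurable_EFinP; exact: measurableT_comp.
- by apply: measurable_funeM; exact: measurable_integrand.
- move=> xi /Dgt0 xi0; rewrite -EFinM lee_fin normrM; apply: le_trans (gh xi xi0).
  by rewrite ler_wpM2l// mx_norm_entry.
Qed.

Lemma phi_intB m (g h : R -> 'rV[R]_m) : inL g -> inL h ->
  phi_int phi (fun xi => g xi - h xi) = phi_int phi g - phi_int phi h.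
Proof.
move=> Lg Lh; apply/rowP => j; rewrite !mxE.
rewrite -(RintegralB mD (integrable_phi j Lg) (integrable_phi j Lh)).
by apply: eq_Rintegral => xi _; rewrite !mxE mulrBr.
Qed.

(** With x = xi t, the left side is at most min(1, x), and min(1, x) <= x^gamma since 0 < gamma <=
    1. The factor xi^gamma is the one present in the weight of L_gamma. *)
Lemma one_sub_expR_le (t xi : R) : 0 < gamma <= 1 -> 0 <= t -> 0 < xi ->
  `|1 - expR (- (xi * t))| <= t `^ gamma * xi `^ gamma.
Proof.
move=> /andP[g0 g1] t0 xi0; rewrite [leRHS]mulrC -powRM ?(ltW xi0)//.
set x := xi * t; have x0 : 0 <= x by rewrite mulr_ge0// ltW.
have e1 : expR (- x) <= 1 by rewrite expR_le1 oppr_le0.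
rewrite ger0_norm ?subr_ge0//.
have [->|xn0] := eqVneq x 0; first by rewrite oppr0 expR0 subrr powR_ge0.
have {}x0 : 0 < x by rewrite lt_neqAle eq_sym xn0.
have [x1|/ltW x1] := leP x 1.
  apply: (@le_trans _ _ x); last by rewrite ger1_powR// x0.
  by rewrite lerBlDl -lerBlDr; exact: expR_ge1Dx.
apply: (@le_trans _ _ 1); first by rewrite gerBl expR_ge0.
by have := ler_powR x1 (ltW g0); rewrite powRr0.
Qed.

(** Dominated convergence, with the integrand of [g] as majorant, treats the times 1 / (n + 1).
    Since 1 - e^(-xi t) increases with t, one such time controls all shorter ones. *)
Lemma decay_cvg p q (g : R -> 'M[R]_(p, q)) (e : R) : inL g -> 0 < e ->
  exists2 d : R, 0 < d & forall t, 0 <= t -> t <= d ->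
    (NL phi gamma (fun xi => (g xi - expR (- (xi * t)) *: g xi)%R) < e%:E)%E.
Proof.
move=> Lg e0; have [mg _] := Lg.
pose df t xi := g xi - expR (- (xi * t)) *: g xi.
have mdf t : mxmeas (df t) by apply: mxmeasB => //; exact: mxmeas_decay.
have dfE t xi : `|df t xi| = `|1 - expR (- (xi * t))| * `|g xi|.
  by rewrite /df -[X in X - _]scale1r -scalerBl normrZ.
pose f_ (n : nat) xi := (wgt xi * `|df n.+1%:R^-1 xi|)%:E.
have ig := integrable_integrand Lg.
have ex (xi t : R) : 0 < xi -> 0 <= t -> expR (- (xi * t)) <= 1.
  by move=> xi0 t0; rewrite expR_le1 oppr_le0 mulr_ge0// ltW.
have [_ _ cv] : [/\ mu.-integrable D (cst 0%E : R -> \bar R),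
   [sequence \int[mu]_(x in D) `|f_ n x - cst 0 x|]_n @ \oo --> 0 &
   [sequence \int[mu]_(x in D) f_ n x]_n @ \oo --> \int[mu]_(x in D) (cst 0 x)]%E.
  apply: (@dominated_convergence _ _ _ mu D mD f_ (cst 0%E) _ _ _ _ ig).
  - by move=> n; apply: measurable_integrand.
  - exact: measurable_cst.
  - apply: aeW => xi _.
    rewrite (_ : cst 0%E xi = (wgt xi * (`|1 - expR (- (xi * 0))| * `|g xi|))%:E); last first.
      by rewrite mulr0 oppr0 expR0 subrr normr0 mul0r mulr0.
    apply: cvg_EFin; first exact: nearW.
    rewrite (_ : fine \o _ = fun n : nat =>
      wgt xi * (`|1 - expR (- (xi * n.+1%:R^-1))| * `|g xi|)); last first.
      by apply/funext => n /=; rewrite dfE.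
    apply: cvgMr; apply: cvgMl; apply: cvg_norm; apply: cvgB; first exact: cvg_cst.
    apply: continuous_cvg; first exact: continuous_expR.
    by apply: cvgN; apply: cvgMr; exact: cvg_harmonic.
  - apply: aeW => xi n /Dgt0 xi0; rewrite gee0_abs ?integrand_ge0//.
    rewrite lee_fin ler_wpM2l ?wgt_ge0// dfE ler_piMl//.
    have e1 := ex xi n.+1%:R^-1 xi0 ltac:(by rewrite invr_ge0).
    by rewrite ger0_norm ?subr_ge0// gerBl expR_ge0.
rewrite integral0 in cv.
have [n _ /(_ n (leqnn n)) hn] : \forall n \near \oo,
    (\int[mu]_(x in D) f_ n x < e%:E)%E.
  apply: (cv [set y | (y < e%:E)%E]); apply: open_nbhs_nbhs; split.
    exact: open_ereal_lt_ereal.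
  by rewrite /= lte_fin.
exists n.+1%:R^-1; first by rewrite invr_gt0.
move=> t t0 tn; apply: le_lt_trans hn.
apply: ge0_le_integral => //.
- by move=> xi _; exact: (integrand_ge0 (df t)).
- by apply: measurable_integrand; exact: mdf.
- by apply: measurable_integrand; exact: mdf.
- move=> xi /Dgt0 xi0; rewrite lee_fin -/(wgt xi) ler_wpM2l ?wgt_ge0//.
  rewrite -/(df t xi) !dfE ler_wpM2r// !ger0_norm ?subr_ge0 ?ex ?invr_ge0//.
  by rewrite lerD2l lerN2 ler_expR lerN2 ler_pM2l.
Qed.

End WeightedL1.

(** * L_gamma as a seminormed group with its decay semigroup *)

(* The elements of L_gamma carry a proof that phi is measurable, which the triangle
   inequality for NL needs. *)
Section LgSpace.
Variables (R : realType) (phi : R -> R) (gamma : R) (m : nat).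
Local Notation D := (`]0%R, +oo[%classic : set R).

Record Lg_space (mphi : measurable_fun D phi) := LgSpace {
  Lg_fun : R -> 'rV[R]_m;
  Lg_in : in_Lg phi gamma Lg_fun }.

Variable mphi : measurable_fun D phi.
Local Notation V := (Lg_space mphi).

HB.instance Definition _ (h : measurable_fun D phi) := gen_eqMixin (Lg_space h).
HB.instance Definition _ (h : measurable_fun D phi) := gen_choiceMixin (Lg_space h).

(** Elements are functions, not classes modulo null sets. Equality is therefore pointwise and
    [Lg_norm] is only a seminorm, as the abstract setting allows. *)
Lemma Lg_ext (u v : V) : (forall xi, Lg_fun u xi = Lg_fun v xi) -> u = v.
Proof.
case: u v => [u Lu] [v Lv] /= /funext uv; move: Lu Lv; rewrite uv => Lu Lv.
by congr LgSpace; exact: Prop_irrelevance.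
Qed.

Definition Lg_zero : V := LgSpace mphi (in_Lg0 phi gamma 1 m).
Definition Lg_opp (u : V) : V := LgSpace mphi (in_LgN (Lg_in u)).
Definition Lg_add (u v : V) : V := LgSpace mphi (in_LgD mphi (Lg_in u) (Lg_in v)).

Lemma Lg_addA : associative Lg_add.
Proof. by move=> u v w; apply: Lg_ext => xi /=; rewrite addrA. Qed.

Lemma Lg_addC : commutative Lg_add.
Proof. by move=> u v; apply: Lg_ext => xi /=; rewrite addrC. Qed.

Lemma Lg_add0 : left_id Lg_zero Lg_add.
Proof. by move=> u; apply: Lg_ext => xi /=; rewrite add0r. Qed.

Lemma Lg_addN : left_inverse Lg_zero Lg_opp Lg_add.
Proof. by move=> u; apply: Lg_ext => xi /=; rewrite addNr. Qed.

HB.instance Definition _ := GRing.isZmodule.Build V Lg_addA Lg_addC Lg_add0 Lg_addN.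

Lemma Lg_funD (u v : V) xi : Lg_fun (u + v) xi = Lg_fun u xi + Lg_fun v xi.
Proof. by []. Qed.

Lemma Lg_funN (u : V) xi : Lg_fun (- u) xi = - Lg_fun u xi.
Proof. by []. Qed.

Definition to_Lg (g : R -> 'rV[R]_m) : V :=
  if pselect (in_Lg phi gamma g) is left Lg then LgSpace mphi Lg else Lg_zero.

Lemma to_LgE g : in_Lg phi gamma g -> Lg_fun (to_Lg g) = g.
Proof. by rewrite /to_Lg; case: pselect. Qed.

Definition Lg_norm (u : V) : R := fine (NL phi gamma (Lg_fun u)).

Lemma Lg_normE u : (Lg_norm u)%:E = NL phi gamma (Lg_fun u).
Proof. by rewrite /Lg_norm fineK// NL_fin//; exact: Lg_in. Qed.

Lemma Lg_meas (u : V) : mxmeas (Lg_fun u). Proof. by case: (Lg_in u). Qed.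

Lemma Lg_norm0 : Lg_norm 0 = 0.
Proof. by apply: EFin_inj; rewrite Lg_normE; exact: NL0. Qed.

Lemma Lg_normN u : Lg_norm (- u) = Lg_norm u.
Proof. by apply: EFin_inj; rewrite !Lg_normE; exact: NLN. Qed.

Lemma Lg_normD u v : Lg_norm (u + v) <= Lg_norm u + Lg_norm v.
Proof. by rewrite -lee_fin EFinD !Lg_normE; apply: NLD => //; exact: Lg_meas. Qed.

Lemma Lg_norm_complete (v : nat -> V) (C q : R) : 0 <= q < 1 ->
  (forall n, Lg_norm (v n.+1 - v n) <= C * q ^+ n) ->
  exists v', forall n, Lg_norm (v n - v') <= C / (1 - q) * q ^+ n.
Proof.
move=> q01 vC.
have [|||v' Lv' hv'] := @Lg_complete R phi gamma mphi m (fun n => Lg_fun (v n)) C q.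
- exact: q01.
- by move=> n; exact: Lg_in.
- by move=> n; have := vC n; rewrite -lee_fin Lg_normE.
- by exists (LgSpace mphi Lv') => n; rewrite -lee_fin Lg_normE; exact: hv'.
Qed.

Lemma max0_ge0 (t : R) : 0 <= Num.max 0 t. Proof. by rewrite le_max lexx. Qed.

(* Clamping t makes the semigroup total on L_gamma; only t >= 0 is meaningful. *)
Definition Lg_decay (t : R) (u : V) : V :=
  LgSpace mphi (in_Lg_decay mphi (max0_ge0 t) (Lg_in u)).

Lemma Lg_decayE t u xi : 0 <= t ->
  Lg_fun (Lg_decay t u) xi = expR (- (xi * t)) *: Lg_fun u xi.
Proof. by move=> t0 /=; rewrite max_r. Qed.

Lemma Lg_decayB t u v : Lg_decay t (u - v) = Lg_decay t u - Lg_decay t v.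
Proof. by apply: Lg_ext => xi; rewrite /= scalerBr. Qed.

Lemma Lg_decay_le t u : 0 <= t -> Lg_norm (Lg_decay t u) <= Lg_norm u.
Proof.
move=> t0; rewrite -lee_fin !Lg_normE.
have h xi : 0 < xi -> `|Lg_fun (Lg_decay t u) xi| <= 1 * `|Lg_fun u xi|.
  by move=> xi0; rewrite Lg_decayE//; exact: decay_le.
have := NL_le gamma mphi (Lg_meas _) (Lg_meas _) ler01 h.
by rewrite mul1e.
Qed.

Lemma Lg_decayD s t u : 0 <= s -> 0 <= t ->
  Lg_decay s (Lg_decay t u) = Lg_decay (s + t) u.
Proof.
move=> s0 t0; apply: Lg_ext => xi; rewrite !Lg_decayE ?addr_ge0//.
by rewrite scalerA -expRD -opprD -mulrDr.
Qed.

Lemma Lg_decay0 u : Lg_decay 0 u = u.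
Proof. by apply: Lg_ext => xi; rewrite Lg_decayE// mulr0 oppr0 expR0 scale1r. Qed.

Definition Lg_int (u : V) := phi_int phi (Lg_fun u).

Lemma Lg_intB u v : Lg_int (u - v) = Lg_int u - Lg_int v.
Proof. by apply: (phi_intB (gamma := gamma)) => //; exact: Lg_in. Qed.

Lemma Lg_int_le u : `|Lg_int u| <= Lg_norm u.
Proof.
rewrite -[leRHS]mul1r; apply: phi_int_le => //; try exact: Lg_in.
move=> xi xi0; rewrite mul1r ler_wpM2r// /wgt ler_peMr// lerDl.
exact: powR_ge0.
Qed.

Lemma Lg_int_decay t u : 0 < gamma <= 1 -> 0 <= t ->
  `|Lg_int (u - Lg_decay t u)| <= t `^ gamma * Lg_norm u.
Proof.
move=> g01 t0; apply: phi_int_le => //; try exact: Lg_in; first exact: powR_ge0.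
move=> xi xi0.
have -> : Lg_fun (u - Lg_decay t u) xi = (1 - expR (- (xi * t))) *: Lg_fun u xi.
  by rewrite Lg_funD Lg_funN Lg_decayE// scalerBl scale1r.
rewrite normrZ mulrA mulrA; apply: ler_wpM2r => //.
rewrite /wgt [leRHS]mulrCA ler_wpM2l//.
apply: le_trans (one_sub_expR_le g01 t0 xi0) _.
by rewrite ler_wpM2l ?powR_ge0// lerDr.
Qed.

End LgSpace.

(** * Passage between the concrete equation and the abstract one *)

Section Application.
Variables (R : realType) (phi : R -> R) (gamma T : R) (d m : nat).
Variables (x1 : R -> R -> R -> 'rV[R]_d).
Hypothesis mphi : measurable_fun (`]0%R, +oo[%classic : set R) phi.
Hypotheses (gamma_gt : 1 / 2 < gamma) (T_gt0 : 0 < T).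
Hypothesis x1_hoelder : tC2_hoelder phi gamma T x1.
Hypothesis x1_chasles : forall t u s, 0 <= s <= u -> u <= t -> t <= T ->
  NL phi gamma (cdelta2 x1 t u s) = 0%E.

Local Notation V := (Lg_space gamma m mphi).
Local Notation S := (@Lg_decay R phi gamma m mphi).
Local Notation N := (@Lg_norm R phi gamma m mphi).

Lemma x1_in t s : 0 <= s -> s <= t -> t <= T -> in_Lg phi gamma (x1 t s).
Proof. by move=> s0 st tT; case: x1_hoelder => -[h _] _; apply: h; rewrite ?s0. Qed.

(* Only x1 t 0 enters, so that the increments dx satisfy Chasles' relation exactly,
   whereas x1 itself does so only almost everywhere. *)
Definition drive (t : R) (z : 'M[R]_(d, m)) : V :=
  if 0 <= t <= T then to_Lg gamma mphi (fun xi => x1 t 0 xi *m z) else 0.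

Local Notation Dx := (dx S drive).

Lemma driveE t z : 0 <= t -> t <= T -> Lg_fun (drive t z) = fun xi => x1 t 0 xi *m z.
Proof.
by move=> t0 tT; rewrite /drive t0 tT to_LgE//; apply: in_Lg_mul => //; exact: x1_in.
Qed.

Lemma driveB t z z' : drive t (z - z') = drive t z - drive t z'.
Proof.
have [/andP[t0 tT]|tn] := boolP (0 <= t <= T).
  apply: Lg_ext => xi; rewrite Lg_funD Lg_funN !driveE//.
  exact: mulmxBr.
by rewrite /drive (negbTE tn) subrr.
Qed.

(** The extra term is the Chasles defect of [x1] at (t, s, 0). It is null in L_gamma but need not
    vanish pointwise, so it is carried along until a norm is taken. *)
Lemma drive_dx t s z xi : 0 <= s -> s <= t -> t <= T ->
  Lg_fun (Dx t s z) xi = x1 t s xi *m z + cdelta2 x1 t s 0 xi *m z.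
Proof.
move=> s0 st tT; rewrite /dx /dl Lg_funD Lg_funN Lg_decayE ?subr_ge0//.
rewrite !driveE// ?(le_trans s0)// ?(le_trans st)//.
rewrite scalemxAl -mulmxBl -mulmxDl; congr (_ *m _).
by rewrite /cdelta2 [RHS]addrC [RHS]addrAC subrK.
Qed.

Lemma cdelta2_meas t s : 0 <= s -> s <= t -> t <= T -> mxmeas (cdelta2 x1 t s 0).
Proof.
move=> s0 st tT; have [t0 sT] := (le_trans s0 st, le_trans st tT).
have [mt0 _] := x1_in (lexx 0) t0 tT; have [mts _] := x1_in s0 st tT.
have [ms0 _] := x1_in (lexx 0) s0 sT.
by apply: mxmeasB; [exact: mxmeasB|exact: mxmeas_decay].
Qed.

Lemma NL_null_mul p q r (g : R -> 'M[R]_(p, q)) (M : 'M[R]_(q, r)) : mxmeas g ->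
  NL phi gamma g = 0%E -> NL phi gamma (fun xi => g xi *m M) = 0%E.
Proof.
move=> mg g0; apply/eqP; rewrite eq_le NL_ge0 andbT.
by apply: le_trans (NL_mul gamma mphi M mg) _; rewrite g0 mule0.
Qed.

Lemma NL_null_sub p q (g n : R -> 'M[R]_(p, q)) : mxmeas g -> mxmeas n ->
  NL phi gamma n = 0%E -> NL phi gamma (fun xi => (g xi - n xi)%R) = NL phi gamma g.
Proof.
move=> mg mn n0; apply/eqP; rewrite eq_le; apply/andP; split.
  by apply: le_trans (NLB gamma mphi mg mn) _; rewrite n0 adde0.
rewrite [leLHS](@eq_NL R phi gamma _ _ _ (fun xi => (g xi - n xi) + n xi)); last first.
  by move=> xi _; rewrite subrK.
by apply: le_trans (NLD gamma mphi (mxmeasB mg mn) mn) _; rewrite n0 adde0.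
Qed.

Lemma drive_null t s (z : 'M[R]_(d, m)) : 0 <= s -> s <= t -> t <= T ->
  NL phi gamma (fun xi => cdelta2 x1 t s 0 xi *m z) = 0%E.
Proof.
move=> s0 st tT; apply: NL_null_mul; first exact: cdelta2_meas.
by apply: x1_chasles => //; rewrite lexx.
Qed.

Lemma x1_bound : exists2 K, 0 <= K & forall t s z, 0 <= s -> s <= t -> t <= T ->
  N (Dx t s z) <= K * (t - s) `^ gamma * `|z|.
Proof.
have [_ [C hC]] := x1_hoelder.
exists (d%:R * `|C|); first by rewrite mulr_ge0.
move=> t s z s0; rewrite le_eqVlt => /predU1P[<- tT|st tT].
  rewrite /dx dl_id; last exact: Lg_decay0.
  by rewrite Lg_norm0 !mulr_ge0// powR_ge0.
have [mts _] := x1_in s0 (ltW st) tT.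
rewrite -lee_fin Lg_normE.
rewrite (@eq_NL R phi gamma _ _ _
  (fun xi => x1 t s xi *m z - - (cdelta2 x1 t s 0 xi *m z))); last first.
  by move=> xi _; rewrite drive_dx ?(ltW st)// opprK.
have mc := mxmeas_mul z (cdelta2_meas s0 (ltW st) tT).
rewrite NL_null_sub; last 3 first.
- exact: mxmeas_mul.
- exact: mxmeasN.
- by rewrite NLN drive_null// ltW.
apply: le_trans (NL_mul gamma mphi z mts) _.
have -> : (d%:R * `|C| * (t - s) `^ gamma * `|z|)%:E =
    ((d%:R * `|z|)%:E * (`|C| * (t - s) `^ gamma)%:E)%E by rewrite -EFinM; congr EFin; ring.
apply: lee_wpmul2l; first by rewrite lee_fin mulr_ge0.
apply: le_trans (hC s t s0 st tT) _; rewrite lee_fin.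
by rewrite ler_wpM2r ?powR_ge0// ler_norm.
Qed.

Lemma dl_NL (y : R -> V) t s : s <= t ->
  (N (dl S y t s))%:E = NL phi gamma (cdelta1 (fun r => Lg_fun (y r)) t s).
Proof.
move=> st; rewrite Lg_normE; apply: eq_NL => xi _.
by rewrite /dl Lg_funD Lg_funN Lg_decayE ?subr_ge0.
Qed.

Lemma young_rem_NL (y : R -> V) (z : R -> 'M[R]_(d, m)) t s :
  0 <= s -> s <= t -> t <= T ->
  (N (young_rem S drive y z t s))%:E =
  NL phi gamma (fun xi => (cdelta1 (fun r => Lg_fun (y r)) t s xi - x1 t s xi *m z s)%R).
Proof.
move=> s0 st tT; rewrite Lg_normE.
have [mts _] := x1_in s0 st tT.
rewrite (@eq_NL R phi gamma _ _ _ (fun xi => cdelta1 (fun r => Lg_fun (y r)) t s xi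
    - x1 t s xi *m z s - cdelta2 x1 t s 0 xi *m z s)).
  apply: NL_null_sub; last exact: drive_null.
  - apply: mxmeasB; last exact: mxmeas_mul.
    by apply: mxmeasB; [|apply: mxmeas_decay]; exact: Lg_meas.
  - by apply: mxmeas_mul; exact: cdelta2_meas.
move=> xi _; rewrite /young_rem Lg_funD Lg_funN drive_dx// opprD addrA.
by rewrite /dl Lg_funD Lg_funN Lg_decayE ?subr_ge0.
Qed.

Lemma Lg_incr_le (y : R -> V) u a b : u <= a -> a <= b ->
  N (y b - y a) <= N (dl S y b u) + N (dl S y a u) + N (y u - S (b - a) (y u)).
Proof.
apply: N_incr_le.
- exact: Lg_normN.
- exact: Lg_normD.
- exact: Lg_decayB.
- exact: Lg_decay_le.
- exact: Lg_decayD.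
Qed.

Lemma path_continuous (y : R -> V) A :
  (forall t s, 0 <= s -> s <= t -> t <= T -> N (dl S y t s) <= A * (t - s) `^ gamma) ->
  forall t e, 0 <= t <= T -> 0 < e -> exists2 del, 0 < del &
    forall t', 0 <= t' <= T -> `|t' - t| < del -> N (y t' - y t) < e.
Proof.
move=> dy t e /andP[t0 tT] e0.
have quarter a b c : a <= e / 4 -> b <= e / 4 -> c < e / 2 -> a + b + c < e by lra.
have gamma0 : 0 < gamma by move: gamma_gt; lra.
have A1 : 0 < 4 * (`|A| + 1) by rewrite mulr_gt0// ltr_wpDl.
have [tau [tau0 ptau _]] := small_window gamma_gt T_gt0 (divr_gt0 e0 A1).
(* The base time lies at most half a window before [t] and precedes every admissible [t'] within tau
   / 2, on either side of [t]. The vector [y u] does not depend on [t'], so the radius from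
   [decay_cvg] can be fixed in advance. *)
pose u := Num.max 0 (t - tau / 2).
have u0 : 0 <= u by rewrite le_max lexx.
have ut : u <= t by rewrite ge_max t0 /= gerBl divr_ge0// ltW.
have e2 : 0 < e / 2 by rewrite divr_gt0.
have [d0 d0_gt0 hd0] := decay_cvg mphi (Lg_in (y u)) e2.
have half0 : 0 < tau / 2 by rewrite divr_gt0.
exists (Num.min (tau / 2) d0); first by rewrite lt_min half0.
have short r : u <= r -> r <= T -> r - u <= tau -> N (dl S y r u) <= e / 4.
  move=> ur rT rtau; apply: le_trans (dy _ _ u0 ur rT) _.
  have pr : (r - u) `^ gamma <= tau `^ gamma.
    by apply: ge0_ler_powR; rewrite ?nnegrE ?subr_ge0// ltW.
  apply: (@le_trans _ _ ((`|A| + 1) * (e / (4 * (`|A| + 1))))).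
    have AA : A <= `|A| + 1 by rewrite (le_trans (ler_norm _))// lerDl.
    apply: le_trans (ler_wpM2r (powR_ge0 _ _) AA) _; apply: ler_wpM2l.
      by rewrite addr_ge0.
    exact: le_trans pr ptau.
  have An : `|A| + 1 != 0 by rewrite gt_eqF// ltr_wpDl.
  by rewrite le_eqVlt; apply/orP; left; apply/eqP; field; rewrite An.
have main a b : u <= a -> a <= b -> b <= T -> b - u <= tau -> b - a <= d0 ->
    N (y b - y a) < e.
  move=> ua ab bT bu ba.
  have ha : N (dl S y a u) <= e / 4 by apply: short => //; lra.
  have hb : N (dl S y b u) <= e / 4 by apply: short => //; lra.
  have hc : N (y u - S (b - a) (y u)) < e / 2.
    rewrite -lte_fin Lg_normE.
    rewrite (@eq_NL R phi gamma _ _ _ (fun xi => Lg_fun (y u) xi -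
        expR (- (xi * (b - a))) *: Lg_fun (y u) xi)).
      by apply: hd0 => //; rewrite subr_ge0.
    by move=> xi _; rewrite Lg_funD Lg_funN Lg_decayE ?subr_ge0.
  apply: le_lt_trans (Lg_incr_le y ua ab) _.
  exact: (quarter _ _ _ hb ha hc).
move=> t' /andP[t'0 t'T]; rewrite lt_min => /andP[h1 h2].
have [h1a h1b] : t' - t < tau / 2 /\ t - t' < tau / 2.
  by move: h1; rewrite ltr_norml; lra.
have ut' : u <= t' by rewrite ge_max t'0 /=; lra.
have tu : t - u <= tau / 2.
  by rewrite lerBlDr -lerBlDl le_max lexx orbT.
have [tt'|/ltW tt'] := leP t t'.
  by apply: main => //; [lra|move: h2; rewrite ger0_norm ?subr_ge0//; exact: ltW].
rewrite -Lg_normN opprB; apply: main => //; first by lra.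
by move: h2; rewrite ler0_norm ?subr_le0// opprB; exact: ltW.
Qed.


Variables (a0 : 'rV[R]_m) (sigma : 'rV[R]_m -> 'M[R]_(d, m)).

Lemma solution_path y : is_solution phi gamma T x1 a0 sigma y ->
  exists (yL : R -> V) (A M C mu : R), [/\ forall t, 0 <= t -> t <= T -> Lg_fun (yL t) = y t,
    0 <= A, 1 < mu & N (yL 0) = 0] /\
  [/\ forall t, 0 <= t -> t <= T -> N (yL t) <= M,
    forall t s, 0 <= s -> s <= t -> t <= T -> N (dl S yL t s) <= A * (t - s) `^ gamma &
    forall t s, 0 <= s -> s <= t -> t <= T ->
      N (young_rem S drive yL (fun r => sigma (a0 + Lg_int (yL r))) t s)
        <= C * (t - s) `^ mu].
Proof.
move=> [[[Ly _] [[M hM] [A hA]]] [y0 [mu [Lam [[mu1 [_ [LLam [[C hC] _]]]] hJ]]]]].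
pose yL t := to_Lg gamma mphi (y t).
have yE t : 0 <= t -> t <= T -> Lg_fun (yL t) = y t.
  by move=> t0 tT; rewrite to_LgE//; apply: Ly; rewrite /in_time t0.
have T0 := ltW T_gt0.
exists yL, `|A|, M, C, mu; split; split => //.
- by apply: EFin_inj; rewrite Lg_normE yE.
- move=> t t0 tT; rewrite -lee_fin Lg_normE yE//; apply: hM.
  by rewrite /in_time t0.
- move=> t s s0; rewrite le_eqVlt => /predU1P[<- tT|st tT].
    rewrite dl_id; last exact: Lg_decay0.
    by rewrite Lg_norm0 mulr_ge0// powR_ge0.
  rewrite -lee_fin dl_NL ?(ltW st)//.
  have [t0 sT] := (le_trans s0 (ltW st), le_trans (ltW st) tT).
  have -> : cdelta1 (fun r => Lg_fun (yL r)) t s = cdelta1 y t s by rewrite /cdelta1 !yE.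
  apply: le_trans (hA s t s0 st tT) _.
  by rewrite lee_fin ler_wpM2r ?powR_ge0// ler_norm.
- move=> t s s0; rewrite le_eqVlt => /predU1P[<- tT|st tT].
    rewrite young_rem_id; last exact: Lg_decay0.
    by rewrite Lg_norm0 subrr powR0 ?mulr0// gt_eqF// (lt_trans _ mu1).
  have [t0 sT] := (le_trans s0 (ltW st), le_trans (ltW st) tT).
  rewrite -lee_fin young_rem_NL// ?(ltW st)//.
  have -> : cdelta1 (fun r => Lg_fun (yL r)) t s = cdelta1 y t s by rewrite /cdelta1 !yE.
  rewrite /Lg_int yE//; set z := sigma _.
  have s0t : 0 <= s <= t by rewrite s0 ltW.
  have [mL _] := LLam t s s0t tT.
  have [mx _] := x1_in s0 (ltW st) tT.
  have mxz := mxmeas_mul z mx.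
  have my : mxmeas (cdelta1 y t s).
    have [mt _] : in_Lg phi gamma (y t) by apply: Ly; rewrite /in_time t0.
    have [ms _] : in_Lg phi gamma (y s) by apply: Ly; rewrite /in_time s0.
    by apply: mxmeasB => //; exact: mxmeas_decay.
  have := hJ t s s0t tT; rewrite -/z => hJ0.
  pose J xi := cdelta1 y t s xi - (x1 t s xi *m z + Lam t s xi).
  have mJ : mxmeas J by apply: mxmeasB => //; exact: mxmeasD.
  (* The remainder is [Lam] plus the null function [J], so it inherits the order [mu] of the sewing
     term. *)
  rewrite (@eq_NL R phi gamma _ _ _ (fun xi => Lam t s xi + J xi)); last first.
    by move=> xi _; rewrite /J opprD (addrA (cdelta1 y t s xi)) [RHS]addrC subrK.
  apply: le_trans (NLD gamma mphi mL mJ) _.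
  by rewrite hJ0 adde0; exact: hC.
Qed.

Lemma solution_of_path (y : R -> V) A M C :
  N (y 0) = 0 -> (forall t, 0 <= t -> t <= T -> N (y t) <= M) ->
  (forall t s, 0 <= s -> s <= t -> t <= T -> N (dl S y t s) <= A * (t - s) `^ gamma) ->
  (forall t s, 0 <= s -> s <= t -> t <= T ->
    N (young_rem S drive y (fun r => sigma (a0 + Lg_int (y r))) t s)
      <= C * (t - s) `^ gamma ^+ 2) ->
  (exists H, forall t s, 0 <= s -> s <= t -> t <= T ->
    `|sigma (a0 + Lg_int (y t)) - sigma (a0 + Lg_int (y s))| <= H * (t - s) `^ gamma) ->
  is_solution phi gamma T x1 a0 sigma (fun t => Lg_fun (y t)).
Proof.
move=> y0 yM dy ry [H zH]; split; last split.
- split; first split.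
  + by move=> t _; exact: Lg_in.
  + move=> t tT e e0; have [del del0 hdel] := path_continuous dy tT e0.
    exists del => // t' t'T tt'; have := hdel t' t'T tt'.
    by rewrite -lte_fin Lg_normE.
  + split; first by exists M => s /andP[s0 sT]; rewrite -Lg_normE lee_fin yM.
    by exists A => s t s0 st tT; rewrite -dl_NL ?(ltW st)// lee_fin dy// ltW.
- by rewrite -Lg_normE y0.
pose z r := sigma (a0 + Lg_int (y r)).
pose Lam t s xi := cdelta1 (fun r => Lg_fun (y r)) t s xi - x1 t s xi *m z s.
have cdL t s : s <= t -> in_Lg phi gamma (cdelta1 (fun r => Lg_fun (y r)) t s).
  move=> st; apply: in_LgB => //; first exact: Lg_in.
  by apply: in_Lg_decay; rewrite ?subr_ge0//; exact: Lg_in.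
(* With [Lam] defined as the remainder, the formula for the integral holds identically; the content
   moves to the order 2 gamma of [Lam], given by [ry], and to its twisted increment. *)
exists (2 * gamma), Lam; split; last first.
  move=> t s _ _; rewrite (@eq_NL R phi gamma _ _ _ (fun=> 0)) ?NL0// => xi _.
  by rewrite /Lam -/(z s) addrC [x1 t s xi *m _ + _]addrC subrK addNr.
split; first by move: gamma_gt; lra.
have Lx t s w : 0 <= s -> s <= t -> t <= T -> in_Lg phi gamma (fun xi => x1 t s xi *m w).
  by move=> s0 st tT; apply: in_Lg_mul => //; exact: x1_in.
split.
  (* One term suffices: [x1] supplies the exponent gamma on [u, t] and [z] the exponent 2 gamma -
     gamma on [s, u]. *)
  exists 1%N, (fun _ t u s xi => x1 t u xi *m (z u - z s)), (fun=> gamma); split.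
    by move=> _; move: gamma_gt; lra.
  split; first by move=> t u s _ _ _ xi; rewrite big_ord1.
  split; first by move=> _ t u s /andP[s0 su] ut tT; apply: Lx => //; exact: le_trans su.
  move=> _; have [_ [C1 hC1]] := x1_hoelder.
  exists (d%:R * `|H| * `|C1|) => t u s s0 su ut tT.
  have u0 : 0 <= u by exact: le_trans (ltW su).
  have [mx _] := x1_in u0 (ltW ut) tT.
  apply: le_trans (NL_mul gamma mphi (z u - z s) mx) _.
  have -> : 2 * gamma - gamma = gamma by ring.
  have -> : (d%:R * `|H| * `|C1| * (t - u) `^ gamma * (u - s) `^ gamma)%:E =
    ((d%:R * (`|H| * (u - s) `^ gamma))%:E * (`|C1| * (t - u) `^ gamma)%:E)%E.
    by rewrite -EFinM; congr EFin; ring.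
  apply: lee_pmul.
  - by rewrite lee_fin mulr_ge0.
  - exact: NL_ge0.
  - rewrite lee_fin ler_wpM2l//; apply: le_trans (zH u s s0 (ltW su) _) _.
      by rewrite (le_trans (ltW ut)).
    by rewrite ler_wpM2r ?powR_ge0// ler_norm.
  - apply: le_trans (hC1 u t u0 ut tT) _.
    by rewrite lee_fin ler_wpM2r ?powR_ge0// ler_norm.
split.
  by move=> t s /andP[s0 st] tT; apply: in_LgB => //; [exact: cdL|exact: Lx].
split.
  exists C => s t s0 st tT; rewrite -powR_sqr.
  by rewrite -young_rem_NL ?(ltW st)// lee_fin; apply: ry => //; exact: ltW.
move=> t u s /andP[s0 su] ut tT.
have [u0 [uT st]] : 0 <= u /\ u <= T /\ s <= t by split; [|split]; lra.
(* The terms in [y] cancel because the exponentials multiply; what is left is the Chasles defect of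
   [x1] applied to [z s]. *)
rewrite (@eq_NL R phi gamma _ _ _ (fun xi => - (cdelta2 x1 t u s xi *m z s))); last first.
  move=> xi _; rewrite /cdelta2 /Lam /cdelta1 mulmxBr !mulmxBl -scalemxAl.
  have -> : expR (- (xi * (t - s))) = expR (- (xi * (t - u))) * expR (- (xi * (u - s))).
    by rewrite -expRD; congr expR; ring.
  move: (x1 t s xi *m z s) (x1 t u xi *m z u) (x1 t u xi *m z s) (x1 u s xi *m z s).
  move: (Lg_fun (y t) xi) (Lg_fun (y s) xi) (Lg_fun (y u) xi) => Yt Ys Yu P Q Q' U.
  by apply/matrixP => i j; rewrite !mxE; ring.
rewrite NLN; apply: NL_null_mul; last by apply: x1_chasles; rewrite ?s0.
have [mts _] := x1_in s0 st tT; have [mtu _] := x1_in u0 ut tT.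
have [mus _] := x1_in s0 su uT.
by apply: mxmeasB; [exact: mxmeasB|exact: mxmeas_decay].
Qed.

End Application.

Theorem theorem3p10 (R : realType) (phi : R -> R) (gamma T : R) (d m : nat)
  (x : R -> 'rV[R]_d) (x1 : R -> R -> R -> 'rV[R]_d)
  (a0 : 'rV[R]_m) (sigma : 'rV[R]_m -> 'M[R]_(d, m)) :
  measurable_fun (`]0%R, +oo[ : set R) phi ->
  1 / 2 < gamma < 1 ->
  0 < T ->
  hoelder_path T gamma x ->
  tC2_hoelder phi gamma T x1 ->
  (forall t u s, 0 <= s <= u -> u <= t -> t <= T ->
     NL phi gamma (cdelta2 x1 t u s) = 0%E) ->
  C2b sigma ->
  (exists y, is_solution phi gamma T x1 a0 sigma y) /\
  (forall y1 y2, is_solution phi gamma T x1 a0 sigma y1 ->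
     is_solution phi gamma T x1 a0 sigma y2 ->
     forall t, in_time T t -> NL phi gamma (fun xi => (y1 t xi - y2 t xi)%R) = 0%E).
Proof.
move=> mphi /andP[gamma_gt gamma_lt1] T_gt0 _ x1_hoelder x1_chasles sigmaC2.
have [C0 [C1 [C2 [C00 C10 C20 [s_le s_lip s_lip2]]]]] := C2b_bounds sigmaC2.
pose F a := sigma (a0 + a).
have F_le a : `|F a| <= C0 by exact: s_le.
have F_lip a b : `|F a - F b| <= C1 * `|a - b|.
  by have := s_lip (a0 + a) (a0 + b); rewrite opprD addrACA subrr add0r.
have F_lip2 a b v : `|F (a + v) - F a - (F (b + v) - F b)| <= C2 * `|v| * `|a - b|.
  have e : a0 + a - (a0 + b) = a - b by rewrite opprD addrACA subrr add0r.
  by have := s_lip2 (a0 + a) (a0 + b) v; rewrite e /F !addrA.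
have gamma01 : 0 < gamma <= 1 by rewrite ltW// andbT; lra.
pose theta : R := 2^-1 `^ gamma.
have th1 : 2 * theta ^+ 2 < 1 by rewrite powR_sqr powR_half_lt//; lra.
(* [c] solves the fixed point equation of the sewing constant; the denominator is positive as 2
   theta^2 = 2^(1 - 2 gamma). *)
pose c := theta ^+ 2 / (1 - 2 * theta ^+ 2).
have c0 : 0 <= c by rewrite divr_ge0 ?sqr_ge0// subr_ge0 ltW.
have c_fix : 2 * theta ^+ 2 * c + theta ^+ 2 = c.
  by rewrite /c; field; rewrite subr_eq0 gt_eqF.
have [K K0 dx_le] := x1_bound m mphi x1_hoelder x1_chasles.
have ell_S t (v : Lg_space gamma m mphi) (t0 : 0 <= t) := Lg_int_decay v gamma01 t0.
split.
  have [y [y0 [M yM] [A dy] [C ry]]] := young_exists gamma_gt T_gt0 K0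
    (@Lg_norm0 _ _ _ _ mphi) (@Lg_normN _ _ _ _ mphi) (@Lg_normD _ _ _ _ mphi)
    (@Lg_norm_complete _ _ _ _ mphi) (@Lg_decayB _ _ _ _ mphi)
    (@Lg_decay_le _ _ _ _ mphi) (@Lg_decayD _ _ _ _ mphi) (@Lg_decay0 _ _ _ _ mphi)
    (@Lg_intB _ _ _ _ mphi) (@Lg_int_le _ _ _ _ mphi) ell_S
    (driveB mphi x1_hoelder) dx_le c0 c_fix C00 C10 C20 F_le F_lip F_lip2.
  exists (fun t => Lg_fun (y t)).
  apply: (solution_of_path gamma_gt T_gt0 x1_hoelder x1_chasles y0 yM dy ry).
  exists (C1 * (A + M)) => t s s0 st tT.
  apply: le_trans (F_lip _ _) _; rewrite -mulrA ler_wpM2l//.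
  have dy' t' s' : 0 <= s' -> s' <= t' -> t' <= T -> t' - s' <= T ->
      Lg_norm (dl (@Lg_decay _ _ _ _ mphi) y t' s') <= A * (t' - s') `^ gamma.
    by move=> s'0 st' tT' _; exact: dy.
  have tsT : t - s <= T by lra.
  exact: (Fell_lip (@Lg_intB _ _ _ _ mphi) (@Lg_int_le _ _ _ _ mphi) ell_S dy' yM
    s0 st tT tsT).
move=> y1 y2 sol1 sol2 t /andP[t0 tT].
have [Y1 [A1 [M1 [B1 [mu1 [[E1 A10 mu1_gt z1] [n1 d1 r1]]]]]]] :=
  solution_path mphi T_gt0 x1_hoelder x1_chasles sol1.
have [Y2 [A2 [M2 [B2 [mu2 [[E2 A20 mu2_gt z2] [n2 d2 r2]]]]]]] :=
  solution_path mphi T_gt0 x1_hoelder x1_chasles sol2.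
pose A := A1 + A2; pose M := Num.max M1 M2; pose B := Num.max B1 B2.
have wk (a b r v mu : R) : a <= b -> v <= a * (r `^ mu) -> v <= b * r `^ mu.
  by move=> ab va; apply: le_trans va _; rewrite ler_wpM2r// powR_ge0.
have lB1 : B1 <= B by rewrite le_max lexx.
have lB2 : B2 <= B by rewrite le_max lexx orbT.
have lA1 : A1 <= A by rewrite lerDl.
have lA2 : A2 <= A by rewrite lerDr.
have A0 : 0 <= A by rewrite addr_ge0.
have n1' r : 0 <= r -> r <= T -> Lg_norm (Y1 r) <= M.
  by move=> r0 rT; rewrite le_max n1.
have n2' r : 0 <= r -> r <= T -> Lg_norm (Y2 r) <= M.
  by move=> r0 rT; rewrite le_max n2// orbT.
(* The solutions enter in reverse order, since [young_unique] treats the second path minus the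
   first. *)
have Y12 := young_unique gamma_gt T_gt0 K0
    (@Lg_norm0 _ _ _ _ mphi) (@Lg_normN _ _ _ _ mphi) (@Lg_normD _ _ _ _ mphi)
    (@Lg_decayB _ _ _ _ mphi) (@Lg_decay_le _ _ _ _ mphi) (@Lg_decayD _ _ _ _ mphi)
    (@Lg_intB _ _ _ _ mphi) (@Lg_int_le _ _ _ _ mphi) ell_S
    (driveB mphi x1_hoelder) dx_le c0 c_fix C10 C20 F_lip F_lip2 A0 mu2_gt mu1_gt z2 z1 n2' n1'
    (fun t s s0 st tT => wk _ _ _ _ _ lA2 (d2 t s s0 st tT))
    (fun t s s0 st tT => wk _ _ _ _ _ lA1 (d1 t s s0 st tT))
    (fun t s s0 st tT => wk _ _ _ _ _ lB2 (r2 t s s0 st tT))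
    (fun t s s0 st tT => wk _ _ _ _ _ lB1 (r1 t s s0 st tT)) t0 tT.
transitivity (Lg_norm (Y1 t - Y2 t))%:E; last by rewrite Y12.
rewrite Lg_normE; apply: eq_NL => xi _.
by rewrite Lg_funD Lg_funN E1// E2.
Qed.
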